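(* Let $k$ be an algebraically closed field of characteristic zero and let $G=\mathrm{Spec}\,A$ be an abelian affine $k$-group. Then there exist a set $X$, a diagonalizable $k$-group $D$, and an isomorphism of $k$-groups $$G=\Big(\prod_X G_a\Big)\times D .$$
   Context: $G=\mathrm{Spec}\,A$ is a commutative affine group scheme over $k$, not assumed of finite type. $G_a=\mathrm{Spec}\,k[x]$ is the additive group. A $k$-group is diagonalizable if each of its linear representations is a direct sum of simple modules of rank $1$. The set $X$ may be infinite. *)

(* Defs.v *)
From HB Require Import structures.
From mathcomp Require Import all_boot all_order all_algebra.
From mathcomp Require Import boolp classical_sets cardinality fsbigop.

Set Implicit Arguments.
Unset Strict Implicit.
Unset Printing Implicit Defensive.

Import GRing.Theory.
Local Open Scope ring_scope.
Local Open Scope quotient_scope.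

(* A k-functor is a functor from commutative k-algebras to sets.  A           *)
(* comAlgType is a nonzero ring; nothing is lost, since a k-group always has  *)
(* a k-point and its group of points over the zero ring is trivial.           *)
Record kfunctor (k : fieldType) := KFunctor {
  points :> comAlgType k -> Type;
  fmap : forall R S : comAlgType k, {lrmorphism R -> S} -> points R -> points S;
  fmap_id : forall (R : comAlgType k) (x : points R),
    fmap (idfun : {lrmorphism R -> R}) x = x;
  fmap_comp : forall (R S T : comAlgType k) (g : {lrmorphism S -> T})
      (f : {lrmorphism R -> S}) (x : points R),
    fmap (g \o f : {lrmorphism R -> T}) x = fmap g (fmap f x)
}.

Lemma lrmorphism_eq (k : fieldType) (R S : comAlgType k)
  (f g : {lrmorphism R -> S}) : f =1 g -> f = g.
Proof.
case: f g => [f [[fD] [fM] [fZ]]] [g [[gD] [gM] [gZ]]] /= /funext efg.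
rewrite /= in efg; subst g.
by rewrite (Prop_irrelevance fD gD) (Prop_irrelevance fM gM)
  (Prop_irrelevance fZ gZ).
Qed.

Section Spec.
Variables (k : fieldType) (A : comAlgType k).

Lemma Spec_id (R : comAlgType k) (x : {lrmorphism A -> R}) :
  ((idfun : {lrmorphism R -> R}) \o x : {lrmorphism A -> R}) = x.
Proof. exact: lrmorphism_eq. Qed.

Lemma Spec_comp (R S T : comAlgType k) (g : {lrmorphism S -> T})
    (f : {lrmorphism R -> S}) (x : {lrmorphism A -> R}) :
  ((g \o f : {lrmorphism R -> T}) \o x : {lrmorphism A -> T}) =
  (g \o (f \o x : {lrmorphism A -> S}) : {lrmorphism A -> T}).
Proof. exact: lrmorphism_eq. Qed.

Definition Spec : kfunctor k :=
  @KFunctor k (fun R => {lrmorphism A -> R}) (fun R S f x => f \o x)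
    Spec_id Spec_comp.

End Spec.

(* A group object structure on F; naturality of the unit and of the inverse   *)
(* follows from that of the product.                                          *)
Record group_law (k : fieldType) (F : kfunctor k) := GroupLaw {
  gmul : forall R : comAlgType k, F R -> F R -> F R;
  gone : forall R : comAlgType k, F R;
  ginv : forall R : comAlgType k, F R -> F R;
  gmulA : forall R : comAlgType k, associative (@gmul R);
  gmul1g : forall R : comAlgType k, left_id (gone R) (@gmul R);
  gmulVg : forall R : comAlgType k, left_inverse (gone R) (@ginv R) (@gmul R);
  gmul_nat : forall (R S : comAlgType k) (f : {lrmorphism R -> S}),
    {morph fmap f : x y / gmul x y}
}.

Definition commutative_law (k : fieldType) (F : kfunctor k)
  (G : group_law F) : Prop :=
  forall R : comAlgType k, commutative (@gmul k F G R).

Definition kgroup_isomorphic (k : fieldType) (F F' : kfunctor k)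
    (G : group_law F) (G' : group_law F') : Prop :=
  exists phi : forall R : comAlgType k, F R -> F' R,
    [/\ forall R, bijective (phi R),
        forall (R S : comAlgType k) (f : {lrmorphism R -> S}) (x : F R),
          phi S (fmap f x) = fmap f (phi R x)
      & forall R, {morph phi R : x y / gmul G x y >-> gmul G' x y}].

Section FamilyProduct.
Variables (k : fieldType) (X : Type) (F : X -> kfunctor k).

Definition prodF : kfunctor k.
Proof.
refine (@KFunctor k (fun R => forall i, F i R)
  (fun R S f x i => fmap f (x i)) _ _).
- by move=> R x; apply: functional_extensionality_dep => i; rewrite fmap_id.
- move=> R S T g f x; apply: functional_extensionality_dep => i.
  by rewrite fmap_comp.
Defined.

Variable G : forall i, group_law (F i).

Definition prod_law : group_law prodF.
Proof.
refine (@GroupLaw k prodF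
  (fun R x y i => gmul (G i) (x i) (y i))
  (fun R i => gone (G i) R) (fun R x i => ginv (G i) (x i)) _ _ _ _).
- by move=> R x y z; apply: functional_extensionality_dep => i; exact: gmulA.
- by move=> R x; apply: functional_extensionality_dep => i; exact: gmul1g.
- by move=> R x; apply: functional_extensionality_dep => i; exact: gmulVg.
- move=> R S f x y; apply: functional_extensionality_dep => i.
  exact: gmul_nat.
Defined.

End FamilyProduct.

Section BinaryProduct.
Variables (k : fieldType) (F F' : kfunctor k).

Definition pairF : kfunctor k.
Proof.
refine (@KFunctor k (fun R => (F R * F' R)%type)
  (fun R S f x => (fmap f x.1, fmap f x.2)) _ _).
- by move=> R [x y] /=; rewrite !fmap_id.
- by move=> R S T g f [x y] /=; rewrite !fmap_comp.
Defined.

Variables (G : group_law F) (G' : group_law F').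

Definition pair_law : group_law pairF.
Proof.
refine (@GroupLaw k pairF
  (fun R x y => (gmul G x.1 y.1, gmul G' x.2 y.2))
  (fun R => (gone G R, gone G' R))
  (fun R x => (ginv G x.1, ginv G' x.2)) _ _ _ _).
- by move=> R [x x'] [y y'] [z z'] /=; rewrite !gmulA.
- by move=> R [x x'] /=; rewrite !gmul1g.
- by move=> R [x x'] /=; rewrite !gmulVg.
- by move=> R S f [x x'] [y y'] /=; rewrite !gmul_nat.
Defined.

End BinaryProduct.

Section AdditiveGroup.
Variable k : fieldType.

Section Point.
Variables (R : comAlgType k) (a : R).

(* horner_alg is k-linear for another, merely propositionally equal, scaling  *)
(* operator on R, hence the repackaging.                                      *)
Definition poly_eval (p : {poly k}) : R := horner_alg a p.

Fact poly_eval_zmod : zmod_morphism poly_eval.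
Proof. by move=> p q; rewrite /poly_eval rmorphB. Qed.

Fact poly_eval_monoid : monoid_morphism poly_eval.
Proof.
by split=> [|p q]; rewrite /poly_eval ?rmorph1 ?rmorphM.
Qed.

Fact poly_eval_scalable : scalable poly_eval.
Proof. by move=> c p; rewrite /poly_eval linearZ /= mulr_algl. Qed.

HB.instance Definition _ :=
  GRing.isZmodMorphism.Build {poly k} R poly_eval poly_eval_zmod.
HB.instance Definition _ :=
  GRing.isMonoidMorphism.Build {poly k} R poly_eval poly_eval_monoid.
HB.instance Definition _ :=
  GRing.isScalable.Build k {poly k} R *:%R poly_eval poly_eval_scalable.

(* The point of Spec k[x] with coordinate a.                                  *)
Definition Ga_point : Spec {poly k} R := poly_eval.

End Point.

Lemma Ga_pointX (R : comAlgType k) (a : R) : Ga_point a 'X = a.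
Proof. exact: horner_algX. Qed.

Lemma Ga_point_eq (R : comAlgType k) (f g : Spec {poly k} R) :
  f 'X = g 'X -> f = g.
Proof.
move=> efg; apply: lrmorphism_eq => p.
by rewrite (poly_alg_initial f) (poly_alg_initial g) efg.
Qed.

Definition Ga : group_law (Spec {poly k}).
Proof.
refine (@GroupLaw k (Spec {poly k})
  (fun R f g => Ga_point (f 'X + g 'X)) (fun R => Ga_point 0)
  (fun R f => Ga_point (- f 'X)) _ _ _ _).
- by move=> R f g h; apply: Ga_point_eq; rewrite !Ga_pointX addrA.
- by move=> R f; apply: Ga_point_eq; rewrite !Ga_pointX add0r.
- by move=> R f; apply: Ga_point_eq; rewrite !Ga_pointX addNr.
- move=> R S h f g; apply: Ga_point_eq.
  by rewrite Ga_pointX /= !Ga_pointX rmorphD.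
Defined.

End AdditiveGroup.


Section Tensor.
Variables (k : fieldType) (V W : lmodType k).

Implicit Type U : lmodType k.

(* A formal sum of pairs (v, w) stands for the sum of the v (x) w; two of     *)
(* them are equal in the tensor product iff no bilinear map separates them.   *)
Definition bilinear_eval U (b : V -> W -> U) (s : seq (V * W)) : U := \sum_(x <- s) b x.1 x.2.

Definition tensor_eq (s t : seq (V * W)) : bool :=
  `[< forall U (b : {bilinear V -> W -> U}),
        bilinear_eval b s = bilinear_eval b t >].

Fact tensor_eq_equiv : equiv_class_of tensor_eq.
Proof.
split=> [s|s t|t s u].
- exact/asboolP.
- by apply/asboolP/asboolP=> est U b; rewrite est.
- by move=> /asboolP est /asboolP etu; apply/asboolP=> U b; rewrite est etu.
Qed.

Canonical tensor_eq_equiv_rel := EquivRelPack tensor_eq_equiv.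

Definition tensor := {eq_quot tensor_eq}.
HB.instance Definition _ := Choice.on tensor.
HB.instance Definition _ := Quotient.on tensor.
HB.instance Definition _ := EqQuotient.on tensor.

Definition tensor_lift U (b : V -> W -> U) (t : tensor) : U :=
  bilinear_eval b (repr t).

Lemma tensor_lift_pi U (b : {bilinear V -> W -> U}) s :
  tensor_lift b (\pi_tensor s) = bilinear_eval b s.
Proof.
rewrite /tensor_lift; case: piP => s' /eqmodP /asboolP e; exact/esym/e.
Qed.

Lemma tensor_eqP (t u : tensor) :
  (forall U (b : {bilinear V -> W -> U}), tensor_lift b t = tensor_lift b u) ->
  t = u.
Proof.
by move=> e; rewrite -[t]reprK -[u]reprK; apply/eqmodP/asboolP=> U b; exact: e.
Qed.

Definition pure (v : V) (w : W) : tensor := \pi_tensor [:: (v, w)].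
Definition tensor_zero : tensor := \pi_tensor [::].
Definition tensor_add (t u : tensor) : tensor := \pi_tensor (repr t ++ repr u).
Definition tensor_scale (c : k) (t : tensor) : tensor :=
  \pi_tensor [seq (c *: x.1, x.2) | x <- repr t].
Definition tensor_opp (t : tensor) : tensor := tensor_scale (-1) t.

Section LiftEquations.
Variables (U : lmodType k) (b : {bilinear V -> W -> U}).

Lemma tensor_lift_pure v w : tensor_lift b (pure v w) = b v w.
Proof. by rewrite tensor_lift_pi /bilinear_eval big_seq1. Qed.

Lemma tensor_lift0 : tensor_lift b tensor_zero = 0.
Proof. by rewrite tensor_lift_pi /bilinear_eval big_nil. Qed.

Lemma tensor_liftD t u :
  tensor_lift b (tensor_add t u) = tensor_lift b t + tensor_lift b u.
Proof. by rewrite tensor_lift_pi /bilinear_eval big_cat. Qed.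

Lemma tensor_liftZ c t :
  tensor_lift b (tensor_scale c t) = c *: tensor_lift b t.
Proof.
rewrite tensor_lift_pi /bilinear_eval big_map scaler_sumr.
by apply: eq_bigr => x _; rewrite linearZl_LR.
Qed.

Lemma tensor_liftN t : tensor_lift b (tensor_opp t) = - tensor_lift b t.
Proof. by rewrite tensor_liftZ scaleN1r. Qed.

End LiftEquations.

Let liftE := (tensor_lift0, tensor_liftD, tensor_liftN, tensor_liftZ).

Fact tensor_addA : associative tensor_add.
Proof. by move=> t u v; apply: tensor_eqP => U b; rewrite !liftE addrA. Qed.

Fact tensor_addC : commutative tensor_add.
Proof. by move=> t u; apply: tensor_eqP => U b; rewrite !liftE addrC. Qed.

Fact tensor_add0 : left_id tensor_zero tensor_add.
Proof. by move=> t; apply: tensor_eqP => U b; rewrite !liftE add0r. Qed.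

Fact tensor_addN : left_inverse tensor_zero tensor_opp tensor_add.
Proof. by move=> t; apply: tensor_eqP => U b; rewrite !liftE addNr. Qed.

HB.instance Definition _ := GRing.isZmodule.Build tensor
  tensor_addA tensor_addC tensor_add0 tensor_addN.

Fact tensor_scaleA a b t :
  tensor_scale a (tensor_scale b t) = tensor_scale (a * b) t.
Proof. by apply: tensor_eqP => U f; rewrite !liftE scalerA. Qed.

Fact tensor_scale1 : left_id 1 tensor_scale.
Proof. by move=> t; apply: tensor_eqP => U f; rewrite !liftE scale1r. Qed.

Fact tensor_scaleDr : right_distributive tensor_scale +%R.
Proof. by move=> a t u; apply: tensor_eqP => U f; rewrite !liftE scalerDr. Qed.

Fact tensor_scaleDl t : {morph tensor_scale^~ t : a b / a + b}.
Proof. by move=> a b; apply: tensor_eqP => U f; rewrite !liftE scalerDl. Qed.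

HB.instance Definition _ := GRing.Zmodule_isLmodule.Build k tensor
  tensor_scaleA tensor_scale1 tensor_scaleDr tensor_scaleDl.

Fact pure_bilinear : bilinear_for *:%R *:%R pure.
Proof.
split=> [w c v v'|v c w w']; apply: tensor_eqP => U b;
  by rewrite !liftE !tensor_lift_pure ?linearPl ?linearPr.
Qed.

HB.instance Definition _ :=
  bilinear_isBilinear.Build k V W tensor *:%R *:%R pure pure_bilinear.

Fact tensor_lift_linear U (b : {bilinear V -> W -> U}) :
  linear (tensor_lift b).
Proof. by move=> c t u; rewrite tensor_liftD tensor_liftZ. Qed.

HB.instance Definition _ U (b : {bilinear V -> W -> U}) :=
  GRing.isLinear.Build k tensor U *:%R (tensor_lift b) (tensor_lift_linear b).

Lemma tensor_sum (t : tensor) : t = \sum_(x <- repr t) pure x.1 x.2.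
Proof.
apply: tensor_eqP => U b; rewrite linear_sum /=.
by apply: eq_bigr => x _; rewrite tensor_lift_pure.
Qed.

Lemma tensor_lift_unique U (f g : {linear tensor -> U}) :
  (forall v w, f (pure v w) = g (pure v w)) -> f =1 g.
Proof.
move=> e t; rewrite (tensor_sum t) !linear_sum; apply: eq_bigr => x _.
exact: e.
Qed.

End Tensor.

Section ScalarExtension.
Variables (k : fieldType) (V : lmodType k).

Section Module.
Variable R : comAlgType k.

(* V (x)_k R with its R-module structure.                                     *)
Definition scalar_ext := tensor V R.
HB.instance Definition _ := GRing.Zmodule.on scalar_ext.

Definition pure_mul (r : R) (v : V) (a : R) : tensor V R := pure v (r * a).

Fact pure_mul_bilinear r : bilinear_for *:%R *:%R (pure_mul r).
Proof.
split=> [a c v v'|v c a a']; first exact: linearPl.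
by rewrite /pure_mul mulrDr -scalerAr linearPr.
Qed.

HB.instance Definition _ r :=
  bilinear_isBilinear.Build k V R (tensor V R) *:%R *:%R (pure_mul r)
    (pure_mul_bilinear r).

Definition ext_scale (r : R) (t : scalar_ext) : scalar_ext :=
  tensor_lift (pure_mul r) t.

Lemma ext_scale_pure r v a : ext_scale r (pure v a) = pure v (r * a).
Proof. exact: tensor_lift_pure. Qed.

Fact ext_scaleDr : right_distributive ext_scale +%R.
Proof. by move=> r t u; rewrite /ext_scale [LHS]linearD. Qed.

Lemma ext_scale_sum r (s : seq (V * R)) :
  ext_scale r (\sum_(x <- s) pure x.1 x.2) = \sum_(x <- s) pure x.1 (r * x.2).
Proof.
rewrite /ext_scale [LHS]linear_sum.
by apply: eq_bigr => x _; exact: ext_scale_pure.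
Qed.

Fact ext_scaleA r s t : ext_scale r (ext_scale s t) = ext_scale (r * s) t.
Proof.
rewrite (tensor_sum t) !ext_scale_sum.
have -> : \sum_(x <- repr t) pure x.1 (s * x.2) =
          \sum_(x <- [seq (x.1, s * x.2) | x <- repr t]) pure x.1 x.2.
  by rewrite big_map.
by rewrite ext_scale_sum big_map; apply: eq_bigr => x _; rewrite mulrA.
Qed.

Fact ext_scale1 : left_id 1 ext_scale.
Proof.
move=> t; rewrite (tensor_sum t) ext_scale_sum.
by apply: eq_bigr => x _; rewrite mul1r.
Qed.

Fact ext_scaleDl t : {morph ext_scale^~ t : r s / r + s}.
Proof.
move=> r s; rewrite (tensor_sum t) !ext_scale_sum -big_split /=.
by apply: eq_bigr => x _; rewrite mulrDl linearDr.
Qed.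

HB.instance Definition _ := GRing.Zmodule_isLmodule.Build R scalar_ext
  ext_scaleA ext_scale1 ext_scaleDr ext_scaleDl.

End Module.

Section Map.
Variables (R S : comAlgType k) (f : {lrmorphism R -> S}).

Definition pure_map (v : V) (a : R) : tensor V S := pure v (f a).

Fact pure_map_bilinear : bilinear_for *:%R *:%R pure_map.
Proof.
split=> [a c v v'|v c a a']; first exact: linearPl.
by rewrite /pure_map linearP linearPr.
Qed.

HB.instance Definition _ :=
  bilinear_isBilinear.Build k V R (tensor V S) *:%R *:%R pure_map
    pure_map_bilinear.

Definition ext_map (t : scalar_ext R) : scalar_ext S := tensor_lift pure_map t.

Lemma ext_map_pure v a : ext_map (pure v a) = pure v (f a).
Proof. exact: tensor_lift_pure. Qed.

End Map.

Definition ext_sub (W : {pred V}) (R : comAlgType k) (t : scalar_ext R) : Prop :=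
  exists2 s : seq (V * R),
    {in s, forall x, x.1 \in W} & t = \sum_(x <- s) (pure x.1 x.2 : scalar_ext R).

End ScalarExtension.

Section Representations.
Variables (k : fieldType) (F : kfunctor k) (G : group_law F).

Record representation (V : lmodType k) := Representation {
  rep : forall R : comAlgType k, F R -> scalar_ext V R -> scalar_ext V R;
  rep_linear : forall (R : comAlgType k) (g : F R), linear (rep g);
  rep1 : forall (R : comAlgType k) (t : scalar_ext V R), rep (gone G R) t = t;
  repM : forall (R : comAlgType k) (g h : F R) (t : scalar_ext V R),
    rep (gmul G g h) t = rep g (rep h t);
  rep_nat : forall (R S : comAlgType k) (f : {lrmorphism R -> S}) (g : F R)
      (t : scalar_ext V R),
    rep (fmap f g) (ext_map f t) = ext_map f (rep g t)
}.

Variables (V : lmodType k) (rho : representation V).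

Definition subrepresentation (W : {pred V}) : Prop :=
  submod_closed W /\
  forall (R : comAlgType k) (g : F R) (t : scalar_ext V R),
    ext_sub W t -> ext_sub W (rep rho g t).

Definition simple_subrepresentation (W : {pred V}) : Prop :=
  [/\ subrepresentation W,
      exists2 v, v \in W & v != 0
    & forall W' : {pred V}, subrepresentation W' -> {subset W' <= W} ->
        W' =i pred1 0 \/ W' =i W].

End Representations.

Definition rank_one (k : fieldType) (V : lmodType k) (W : {pred V}) : Prop :=
  exists2 v : V, v != 0 & forall w : V, w \in W <-> exists c : k, w = c *: v.

Definition is_direct_sum (k : fieldType) (V : lmodType k) (I : choiceType)
    (W : I -> {pred V}) : Prop :=
  forall v : V, exists! f : I -> V,
    [/\ finite_set [set i | f i != 0]%classic, forall i, f i \in W i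
      & v = \sum_(i \in [set: I]%classic) f i].

Definition diagonalizable_group (k : fieldType) (F : kfunctor k)
    (G : group_law F) : Prop :=
  forall (V : lmodType k) (rho : representation G V),
  exists (I : choiceType) (W : I -> {pred V}),
    (forall i, simple_subrepresentation rho (W i) /\ rank_one (W i)) /\
    is_direct_sum W.

(* Main.v *)
Require Import Defs.
From HB Require Import structures.
From mathcomp Require Import all_boot all_order all_algebra ring.
From mathcomp Require Import boolp classical_sets cardinality fsbigop.

(** Write G = Spec A.  A linear form phi on A acts on A by
    a |-> sum phi(a_1) a_2; these operators commute and are locally finite, so A
    is the direct sum of the generalized eigenspaces A_chi indexed by the
    group-like elements chi.  Sending a in A_chi to eps(a) chi is a retraction s
    of A onto the Hopf subalgebra B spanned by the group-like elements, and
    D = Spec B.  The point u = id * s^-1 is unipotent: u - eps is locally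
    nilpotent for convolution.  The powers u^n are polynomial in n, and the
    coefficient e of n is an eps-derivation with values in the space P of
    primitive elements, equal to the identity on P, and such that u = exp(e).
    Hence g |-> (g|P, g|B) is an isomorphism of G(R) onto Hom_k(P, R) x D(R) with
    inverse (f, d) |-> exp(f o e) * (d o s); a basis of P gives the coordinates
    in the product of copies of G_a. *)

Set Implicit Arguments.
Unset Strict Implicit.
Unset Printing Implicit Defensive.

Import GRing.Theory.
Local Open Scope ring_scope.

(** * Linear algebra over a field *)

(** The tensor product is known only through bilinear maps, so elements of A (x) A are written as
    finite sums with the help of linear functionals, and the Hopf identities are read off from the
    group law at universal points: the identity of A and the injections of A into its tensor powers.
    The translations commute because G does, and algebraic closedness splits the polynomials that
    annihilate them locally; as A may be infinite dimensional, eigenvectors are sought modulo the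
    elements already known to decompose. The logarithm of u is not taken through its series: u^n(a)
    is a binomial sum whose length is bounded independently of n, and in characteristic zero a
    polynomial is determined by its values at the natural numbers, so that every identity for e is a
    comparison of coefficients in an identity between powers of u. Conversely, prescribed values on
    P are extended to a linear map f on A; then f o e is an eps-derivation whose exponential is a
    finite sum on each element. *)

Section LinearAlgebra.
Variable k : fieldType.

(* Sealed, so that simplification does not unfold the maps built with it. *)
Fact mklin_key (V U : lmodType k) (f : V -> U) (fP : linear f) :
  {g : {linear V -> U} | g =1 f}.
Proof.
by exists (HB.pack_for {linear V -> U} f
  (GRing.isLinear.Build k V U *:%R f fP)).
Qed.

Definition mklin (V U : lmodType k) (f : V -> U) (fP : linear f) :
  {linear V -> U} := sval (mklin_key fP).

Lemma mklinE (V U : lmodType k) (f : V -> U) (fP : linear f) : mklin fP =1 f.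
Proof. exact: svalP (mklin_key fP). Qed.

Section Basis.
Variable V : lmodType k.
Implicit Types (S X : V -> Prop) (l : seq (k * V)).

Definition comb l : V := \sum_(z <- l) z.1 *: z.2.
Definition inside X l := {in l, forall z, X z.2}.
(** A combination is a list in which a vector may occur several times, so independence has to speak
    of collected coefficients. *)
Definition coef l x : k := \sum_(z <- l | z.2 == x) z.1.
Definition spanned X v := exists2 l, inside X l & v = comb l.
Definition independent X :=
  forall l, inside X l -> comb l = 0 -> forall x, coef l x = 0.

Lemma comb_regroup (U : lmodType k) (f : V -> U) l (s : seq V) :
  uniq s -> {in l, forall z, z.2 \in s} ->
  \sum_(z <- l) z.1 *: f z.2 = \sum_(x <- s) coef l x *: f x.
Proof.
move=> us ls; under [RHS]eq_bigr do rewrite scaler_suml big_mkcond.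
rewrite exchange_big /= !big_seq; apply: eq_bigr => z zl.
rewrite -big_mkcond /= -big_filter.
rewrite (eq_filter (a2 := pred1 z.2)) => [|x]; last by rewrite /= eq_sym.
by rewrite filter_pred1_uniq ?ls // big_seq1.
Qed.

Lemma inside_cat X l l' : inside X l -> inside X l' -> inside X (l ++ l').
Proof. by move=> il il' z; rewrite mem_cat => /orP[/il|/il']. Qed.

Lemma comb_cat l l' : comb (l ++ l') = comb l + comb l'.
Proof. exact: big_cat. Qed.

Definition scale_comb (c : k) l := [seq (c * z.1, z.2) | z <- l].

Lemma inside_scale X c l : inside X l -> inside X (scale_comb c l).
Proof. by move=> il _ /mapP[z zl ->]; exact: (il z). Qed.

Lemma comb_scale c l : comb (scale_comb c l) = c *: comb l.
Proof.
by rewrite /comb big_map scaler_sumr; apply: eq_bigr => z _; rewrite scalerA.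
Qed.

Lemma spanned_in X x : X x -> spanned X x.
Proof.
move=> Xx; exists [:: (1, x)]; last by rewrite /comb big_seq1 scale1r.
by move=> z; rewrite inE => /eqP->.
Qed.

Lemma spanned_sum X (I : eqType) (r : seq I) (F : I -> V) :
  {in r, forall i, spanned X (F i)} -> spanned X (\sum_(i <- r) F i).
Proof.
move=> FX; rewrite big_seq; elim/big_ind: _ => //.
- by exists [::] => //; rewrite /comb big_nil.
- move=> _ _ [l il ->] [l' il' ->]; exists (l ++ l'); rewrite ?comb_cat //.
  exact: inside_cat.
Qed.

Lemma spanned_scale X c v : spanned X v -> spanned X (c *: v).
Proof.
by case=> l il ->; exists (scale_comb c l); rewrite ?comb_scale //;
  exact: inside_scale.
Qed.

Lemma spanned_trans X X' v :
  (forall x, X x -> spanned X' x) -> spanned X v -> spanned X' v.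
Proof.
by move=> XX' [l il ->]; apply: spanned_sum => z /il/XX'; exact: spanned_scale.
Qed.

(* A maximal independent subset of S among those containing X spans S. *)
Lemma basis_exists X S : independent X -> (forall x, X x -> S x) ->
  exists Y, [/\ forall x, X x -> Y x, forall y, Y y -> S y, independent Y
    & forall v, S v -> spanned Y v].
Proof.
move=> iX XS.
(* Zorn's lemma is applied to the part added to [X], so that the empty chain is covered by the
   independence of [X]. *)
pose U (Y : V -> Prop) x := X x \/ Y x.
pose P : set (set V) := fun Y => independent (U Y) /\ forall x, U Y x -> S x.
have [F FP Ftot|Y [[iY YS] Ymax]] := @Zorn_bigcup V P.
  split; last first.
    by move=> x [/XS //|[Y FY Yx]]; apply: (FP _ FY).2; right.
  move=> l il.
  (* A list is finite and the chain is nested: the vectors lie in [X] together with a single member,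
     or in [X] alone. *)
  have [lX|[Y FY lY]]: inside X l \/ exists2 Y, F Y & inside (U Y) l.
    elim: l il => [_|z l IH il]; first by left.
    have /IH{IH} lX : inside (U (\bigcup_(Y in F) Y)%classic) l.
      by move=> w wl; apply: il; rewrite inE wl orbT.
    have := il z (mem_head _ _); case=> [Xz|[Y FY Yz]].
      case: lX => [lX|[Y FY lY]]; [left|right; exists Y => //].
        by move=> w; rewrite inE => /orP[/eqP->|/lX].
      by move=> w; rewrite inE => /orP[/eqP->|/lY //]; left.
    right; case: lX => [lX|[Y' FY' lY']].
      exists Y => // w; rewrite inE => /orP[/eqP->|/lX]; first by right.
      by left.
    have [YY'|Y'Y] := Ftot _ _ FY FY'.
      exists Y' => // w; rewrite inE => /orP[/eqP->|/lY'//].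
      by right; exact: YY'.
    exists Y => // w; rewrite inE => /orP[/eqP->|/lY' [Xw|/Y'Y Yw]].
    - by right.
    - by left.
    - by right.
  - exact: iX.
  - by have [+ _] := FP _ FY; apply.
exists (U Y); split => //; first by left.
move=> v Sv; apply: contrapT => nv.
have Yv : ~ Y v by move=> Yv; apply: nv; apply: spanned_in; right.
apply: (Ymax (fun x => Y x \/ x = v)); first split.
- by left.
- by move=> /(_ v (or_intror erefl)).
split; last by move=> x [/XS //|[Yx|->//]]; apply: YS; right.
move=> l il l0; pose l' := [seq z <- l | z.2 != v].
have il' : inside (U Y) l'.
  move=> z; rewrite mem_filter => /andP[zv /il [|[]]]; first by left.
    by right.
  by move=> zv'; rewrite zv' eqxx in zv.
have e : coef l v *: v + comb l' = 0.
  rewrite -[RHS]l0 /comb big_filter [RHS](bigID (fun z => z.2 == v)) /=.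
  by congr (_ + _); rewrite scaler_suml; apply: eq_bigr => z /eqP->.
(* A non-zero coefficient would express [v] through [U Y]. *)
have c0 : coef l v = 0.
  apply: contrapT => /eqP c0; apply: nv.
  exists (scale_comb (- (coef l v)^-1) l'); first exact: inside_scale.
  rewrite comb_scale -[comb l'](addKr (coef l v *: v)) e addr0.
  by rewrite scalerN scaleNr opprK scalerA mulVf // scale1r.
move=> x; case: (eqVneq x v) => [->//|xv].
rewrite c0 scale0r add0r in e; rewrite -(iY l' il' e x) /coef big_filter_cond.
by apply: eq_bigl => z; case: eqP => [->|]; rewrite ?xv ?andbF.
Qed.

Lemma independent0 : independent (fun=> False).
Proof.
move=> [|z l] il _ x; first by rewrite /coef big_nil.
by case: (il z (mem_head _ _)).
Qed.

Lemma independent1 v : v != 0 -> independent (eq v).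
Proof.
move=> v0 l il l0 x; case: (eqVneq v x) => [<-|vx]; last first.
  by rewrite /coef big_seq_cond big_pred0 // => z; apply/andP=> -[/il <-];
    exact/negP.
have /(comb_regroup id (s := [:: v]) isT) : {in l, forall z, z.2 \in [:: v]}.
  by move=> z /il <-; rewrite inE.
rewrite -/(comb l) l0 big_seq1 => /esym/eqP.
by rewrite scaler_eq0 (negPf v0) orbF => /eqP.
Qed.

Lemma linear_extension X (U : lmodType k) (f : V -> U) :
  independent X -> (forall v, spanned X v) ->
  exists L : {linear V -> U}, forall x, X x -> L x = f x.
Proof.
move=> iX sX; have /choice[g gP] v : exists l, inside X l /\ v = comb l.
  by have [l il ->] := sX v; exists l.
pose ev l := \sum_(z <- l) z.1 *: f z.2.
(* By independence the value of a combination depends only on its sum, so the arbitrary choice [g]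
   yields a linear map. *)
have ev0 l : inside X l -> comb l = 0 -> ev l = 0.
  move=> il l0; rewrite /ev (@comb_regroup _ f l (undup [seq z.2 | z <- l])).
  - by rewrite big1 // => x _; rewrite (iX l il l0) scale0r.
  - exact: undup_uniq.
  - by move=> z zl; rewrite mem_undup; apply: map_f.
have evZ c l : ev (scale_comb c l) = c *: ev l.
  by rewrite /ev big_map scaler_sumr; apply: eq_bigr => z _; rewrite scalerA.
have evE l l' : inside X l -> inside X l' -> comb l = comb l' -> ev l = ev l'.
  move=> il il' e; apply/eqP; rewrite -subr_eq0 -scaleN1r -evZ.
  rewrite -[_ + _]big_cat /=; apply/eqP/ev0.
    by apply: inside_cat => //; exact: inside_scale.
  by rewrite comb_cat comb_scale e scaleN1r subrr.
have fP : linear (fun v => ev (g v)).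
  move=> c u v; rewrite -evZ -[RHS]big_cat; apply: evE.
  - exact: (gP _).1.
  - by apply: inside_cat; [apply: inside_scale|]; exact: (gP _).1.
  - by rewrite comb_cat comb_scale -!(gP _).2.
exists (mklin fP) => x Xx; rewrite mklinE (evE _ [:: (1, x)]).
- by rewrite /ev big_seq1 scale1r.
- exact: (gP _).1.
- by move=> z; rewrite inE => /eqP->.
- by rewrite -(gP _).2 /comb big_seq1 scale1r.
Qed.

(** The list [s] gathers the basis vectors occurring in any member of [r], so that a finite family
    is handled with one finite set of coordinates. *)
Lemma coordinates X : independent X -> (forall v, spanned X v) ->
  exists p : V -> {linear V -> k^o},
    (forall x y, X y -> p x y = (y == x)%:R :> k) /\
    forall r : seq V, exists s : seq V, [/\ uniq s, {in s, forall x, X x} &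
      {in r, forall v, v = \sum_(x <- s) p x v *: x}].
Proof.
move=> iX sX.
have /choice[p pP] x : exists p : {linear V -> k^o},
    forall y, X y -> p y = (y == x)%:R :> k.
  exact: linear_extension.
exists p; split=> // r; have /choice[l lP] v : exists l, inside X l /\ v = comb l.
  by have [l il ->] := sX v; exists l.
exists (undup (flatten [seq [seq z.2 | z <- l v] | v <- r])).
split=> [|x|v vr]; first exact: undup_uniq.
  rewrite mem_undup => /flattenP[_ /mapP[v _ ->] /mapP[z zl ->]].
  exact: (lP v).1.
set s := undup _; have ls : {in l v, forall z, z.2 \in s}.
  move=> z zl; rewrite mem_undup; apply/flattenP.
  exists [seq z.2 | z <- l v]; last exact: map_f.
  exact: (map_f (fun v => [seq z.2 | z <- l v]) vr).
rewrite [LHS](lP v).2 [LHS](comb_regroup id (undup_uniq _) ls).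
apply: eq_bigr => x _; congr (_ *: _); rewrite {2}(lP v).2 linear_sum /=.
rewrite /coef big_mkcond /=; apply: eq_big_seq => z zl.
by rewrite linearZ /= (pP x _ ((lP v).1 z zl)) /GRing.scale /= mulrb; case: ifP;
  rewrite ?mulr1 ?mulr0.
Qed.

Lemma basis_extension S X : independent X -> (forall x, X x -> S x) ->
  (forall v, spanned S v) ->
  exists Y, [/\ forall x, X x -> Y x, forall y, Y y -> S y, independent Y
    & forall v, spanned Y v].
Proof.
move=> iX XS sS; have [Y [XY YS iY sY]] := basis_exists iX XS.
by exists Y; split=> // v; apply: spanned_trans (sS v).
Qed.

Lemma spannedT v : spanned (fun=> True) v.
Proof. exact: spanned_in. Qed.

Lemma functional_separates v : v != 0 -> exists f : {linear V -> k^o}, f v != 0.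
Proof.
move=> v0; have [//|Y [vY _ iY sY]] :=
  @basis_extension (fun=> True) _ (independent1 v0) _ spannedT.
have [f fP] := @linear_extension Y k^o (fun=> 1) iY sY.
by exists f; rewrite fP ?oner_eq0 //; exact: vY.
Qed.

Lemma functional_eq u v : (forall f : {linear V -> k^o}, f u = f v) -> u = v.
Proof.
move=> e; apply/eqP; rewrite -subr_eq0; apply: contraT.
by case/functional_separates => f; rewrite linearB /= e subrr eqxx.
Qed.

Lemma finite_rank_identity (r : seq V) :
  exists s : seq (V * {linear V -> k^o}),
    {in r, forall v, v = \sum_(z <- s) z.2 v *: z.1}.
Proof.
have [//|Y [_ _ iY sY]] := @basis_extension (fun=> True) _ independent0 _ spannedT.
have [p [_ pP]] := coordinates iY sY; have [s [_ _ sP]] := pP r.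
by exists [seq (x, p x) | x <- s] => v vr; rewrite big_map; exact: sP.
Qed.

Lemma independent_neq0 X x : independent X -> X x -> x != 0.
Proof.
move=> iX Xx; apply/eqP=> x0; have := iX [:: (1, x)].
rewrite /comb big_seq1 x0 scaler0 => /(_ _ erefl 0) c0.
have : coef [:: (1 : k, 0 : V)] 0 = 0.
  by apply: c0 => z; rewrite inE => /eqP->; rewrite -x0.
by rewrite /coef big_cons eqxx big_nil addr0 => /eqP; rewrite oner_eq0.
Qed.

End Basis.

Definition mkbil (V W U : lmodType k) (f : V -> W -> U)
    (fP : bilinear_for *:%R *:%R f) : {bilinear V -> W -> U} :=
  HB.pack f (bilinear_isBilinear.Build k V W U *:%R *:%R f fP).

Section Contraction.
Variables (V W : lmodType k) (f : {linear V -> k^o}).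

Fact contract_bilinear :
  bilinear_for *:%R *:%R (fun v w => (f v : k) *: w : W).
Proof.
split=> [w c v v'|v c w w'] /=.
  by rewrite linearP scalerDl -scalerA.
by rewrite scalerDr !scalerA mulrC.
Qed.

Definition contract : {linear tensor V W -> W} :=
  mklin (tensor_lift_linear (mkbil contract_bilinear)).

Lemma contract_pure v w : contract (pure v w) = (f v : k) *: w.
Proof. rewrite mklinE; exact: tensor_lift_pure. Qed.

End Contraction.

(** Expanding the finitely many left factors in a dual system moves all coefficients to the right,
    where they add up to contractions of [t]. *)
Lemma tensor_expand (V W : lmodType k) (t : tensor V W) :
  exists s : seq (V * {linear V -> k^o}),
    t = \sum_(z <- s) pure z.1 (contract W z.2 t).
Proof.
have [s sP] := finite_rank_identity [seq x.1 | x <- repr t].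
exists s; rewrite [in LHS](tensor_sum t) [in RHS](tensor_sum t).
under [RHS]eq_bigr do rewrite linear_sum linear_sumr.
rewrite exchange_big /=; apply: eq_big_seq => x xt.
rewrite {1}(sP x.1 (map_f _ xt)) linear_sumlz /=.
by apply: eq_bigr => z _; rewrite contract_pure linearZl_LR linearZr_LR.
Qed.

End LinearAlgebra.

(** * The algebra structure on a tensor product *)

Lemma tensor_ind (k : fieldType) (V W : lmodType k) (P : tensor V W -> Prop) :
  P 0 -> (forall t u, P t -> P u -> P (t + u)) -> (forall v w, P (pure v w)) ->
  forall t, P t.
Proof.
by move=> P0 PD Pp t; rewrite (tensor_sum t); elim/big_ind: _ => // z _.
Qed.

Section TensorAlgebra.
Variables (k : fieldType) (A B : comAlgType k).
Implicit Types t u v : tensor A B.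

Section Inner.
Variables (x : A) (y : B).
Fact inner_bilinear : bilinear_for *:%R *:%R (fun a b => pure (x * a) (y * b)).
Proof.
split=> [b c a a'|a c b b'] /=; rewrite mulrDr -scalerAr.
  by rewrite linearPl.
by rewrite linearPr.
Qed.
Definition tensor_mul_pure : {linear tensor A B -> tensor A B} :=
  tensor_lift (mkbil inner_bilinear).
End Inner.

Fact outer_bilinear u : bilinear_for *:%R *:%R (fun x y => tensor_mul_pure x y u).
Proof.
split=> [y c x x'|x c y y'] /=; rewrite /tensor_lift /bilinear_eval scaler_sumr;
  rewrite -big_split; apply: eq_bigr => z _ /=;
  rewrite mulrDl -scalerAl ?linearPl ?linearPr //.
Qed.

Definition tensor_mul t u := tensor_lift (mkbil (outer_bilinear u)) t.

Lemma tensor_mulE a b u : tensor_mul (pure a b) u = tensor_mul_pure a b u.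
Proof. exact: tensor_lift_pure. Qed.

Lemma tensor_mul_pureE a b a' b' :
  tensor_mul_pure a b (pure a' b') = pure (a * a') (b * b').
Proof. exact: tensor_lift_pure. Qed.

Fact tensor_mulDl : left_distributive tensor_mul +%R.
Proof. by move=> t t' u; rewrite /tensor_mul [LHS]linearD. Qed.

Lemma tensor_mulZl c t u : c *: tensor_mul t u = tensor_mul (c *: t) u.
Proof. by rewrite /tensor_mul [RHS]linearZ. Qed.

Lemma tensor_mul0l u : tensor_mul 0 u = 0.
Proof. by rewrite /tensor_mul [LHS]linear0. Qed.

(** Linearity in the second argument is at hand only when the first one is a pure tensor, hence the
    double induction; the general case is deduced from commutativity. *)
Fact tensor_mulC : commutative tensor_mul.
Proof.
elim/tensor_ind=> [u|t t' IH IH' u|a b].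
- rewrite tensor_mul0l; elim/tensor_ind: u => [|u v e e'|a b].
  + by rewrite tensor_mul0l.
  + by rewrite tensor_mulDl -e -e' addr0.
  + by rewrite tensor_mulE linear0.
- rewrite tensor_mulDl IH IH'; elim/tensor_ind: u => [|u v e e'|a b].
  + by rewrite !tensor_mul0l addr0.
  + by rewrite !tensor_mulDl -e -e' addrACA.
  + by rewrite !tensor_mulE linearD.
- elim/tensor_ind => [|u v e e'|a' b'].
  + by rewrite tensor_mul0l tensor_mulE linear0.
  + by rewrite tensor_mulDl -e -e' !tensor_mulE linearD.
  + by rewrite !tensor_mulE !tensor_mul_pureE mulrC [b * _]mulrC.
Qed.

Fact tensor_mulDr : right_distributive tensor_mul +%R.
Proof. by move=> t u v; rewrite tensor_mulC tensor_mulDl ![tensor_mul _ t]tensor_mulC. Qed.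

Fact tensor_mulA : associative tensor_mul.
Proof.
elim/tensor_ind=> [u v|t t' IH IH' u v|a b].
- by rewrite !tensor_mul0l.
- by rewrite !tensor_mulDl IH IH'.
elim/tensor_ind=> [v|t t' IH IH' v|a' b'].
- by rewrite ![tensor_mul _ 0]tensor_mulC !tensor_mul0l tensor_mulC tensor_mul0l.
- by rewrite tensor_mulDr !tensor_mulDl -IH -IH' tensor_mulDr.
elim/tensor_ind=> [|t t' IH IH'|a'' b''].
- by rewrite ![tensor_mul _ 0]tensor_mulC !tensor_mul0l tensor_mulC tensor_mul0l.
- by rewrite !tensor_mulDr IH IH'.
- by rewrite !(tensor_mulE, tensor_mul_pureE) !mulrA.
Qed.

Fact tensor_mul1 : left_id (pure 1 1) tensor_mul.
Proof.
elim/tensor_ind=> [|t t' IH IH'|a b].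
- by rewrite tensor_mulE linear0.
- by rewrite tensor_mulDr IH IH'.
- by rewrite tensor_mulE tensor_mul_pureE !mul1r.
Qed.

Fact tensor_one_neq0 : (pure 1 1 : tensor A B) != 0.
Proof.
have [f f1] := functional_separates (oner_neq0 A).
apply/eqP=> /(congr1 (contract B f)); rewrite contract_pure linear0 => /eqP.
by rewrite scaler_eq0 (negPf f1) oner_eq0.
Qed.

HB.instance Definition _ := GRing.Zmodule_isComNzRing.Build (tensor A B)
  tensor_mulA tensor_mulC tensor_mul1 tensor_mulDl tensor_one_neq0.
HB.instance Definition _ := GRing.Lmodule_isLalgebra.Build k (tensor A B)
  tensor_mulZl.
HB.instance Definition _ := GRing.Lalgebra_isComAlgebra.Build k (tensor A B).

End TensorAlgebra.

Definition talg (k : fieldType) (A B : comAlgType k) : comAlgType k := tensor A B.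

Section TensorAlgebraTheory.
Variables (k : fieldType) (A B : comAlgType k).

Definition tpure (a : A) (b : B) : talg A B := pure a b.

Lemma tpureM a b a' b' : tpure a b * tpure a' b' = tpure (a * a') (b * b').
Proof. by rewrite [LHS]tensor_mulE tensor_mul_pureE. Qed.

Lemma tpure11 : tpure 1 1 = 1. Proof. by []. Qed.

Lemma tpurePl c a a' b : tpure (c *: a + a') b = c *: tpure a b + tpure a' b.
Proof. exact: linearPl. Qed.

Lemma tpurePr c a b b' : tpure a (c *: b + b') = c *: tpure a b + tpure a b'.
Proof. exact: linearPr. Qed.

Lemma tpureDr a b b' : tpure a (b + b') = tpure a b + tpure a b'.
Proof. exact: linearDr. Qed.

Lemma tpureZl c a b : tpure (c *: a) b = c *: tpure a b.
Proof. exact: linearZl_LR. Qed.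

Lemma tpureZr c a b : tpure a (c *: b) = c *: tpure a b.
Proof. exact: linearZr_LR. Qed.

Lemma tpure0r a : tpure a 0 = 0. Proof. exact: linear0r. Qed.

Lemma tpureBr a b b' : tpure a (b - b') = tpure a b - tpure a b'.
Proof. exact: linearBr. Qed.

Lemma tpure_suml (I : Type) (r : seq I) (F : I -> A) b :
  tpure (\sum_(i <- r) F i) b = \sum_(i <- r) tpure (F i) b.
Proof. exact: linear_sumlz. Qed.

Lemma talg_ind (P : talg A B -> Prop) :
  P 0 -> (forall t u, P t -> P u -> P (t + u)) -> (forall a b, P (tpure a b)) ->
  forall t, P t.
Proof. exact: tensor_ind. Qed.

End TensorAlgebraTheory.

Section AlgebraMorphisms.
Variable k : fieldType.

Fact mkalg_key (A B : comAlgType k) (f : A -> B) (fL : linear f)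
  (fM : monoid_morphism f) : {g : {lrmorphism A -> B} | g =1 f}.
Proof.
by exists (HB.pack_for {lrmorphism A -> B} f
  (GRing.isLinear.Build k A B *:%R f fL)
  (GRing.isMonoidMorphism.Build A B f fM)).
Qed.

Definition mkalg (A B : comAlgType k) (f : A -> B) (fL : linear f)
  (fM : monoid_morphism f) : {lrmorphism A -> B} := sval (mkalg_key fL fM).

Lemma mkalgE (A B : comAlgType k) (f : A -> B) (fL : linear f)
  (fM : monoid_morphism f) : mkalg fL fM =1 f.
Proof. exact: svalP (mkalg_key fL fM). Qed.

Variables A B : comAlgType k.

Fact inj1_linear : linear (fun a : A => tpure a (1 : B)).
Proof. by move=> c a b; rewrite tpurePl. Qed.
Fact inj1_monoid : monoid_morphism (fun a : A => tpure a (1 : B)).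
Proof. by split=> // a b; rewrite tpureM mulr1. Qed.
Definition inj1 : {lrmorphism A -> talg A B} := mkalg inj1_linear inj1_monoid.

Fact inj2_linear : linear (fun b : B => tpure (1 : A) b).
Proof. by move=> c a b; rewrite tpurePr. Qed.
Fact inj2_monoid : monoid_morphism (fun b : B => tpure (1 : A) b).
Proof. by split=> // a b; rewrite tpureM mulr1. Qed.
Definition inj2 : {lrmorphism B -> talg A B} := mkalg inj2_linear inj2_monoid.

Lemma inj1E a : inj1 a = tpure a 1. Proof. exact: mkalgE. Qed.
Lemma inj2E b : inj2 b = tpure 1 b. Proof. exact: mkalgE. Qed.

Variables (R : comAlgType k) (f : {linear A -> R}) (g : {linear B -> R}).

Fact mul2_bilinear : bilinear_for *:%R *:%R (fun a b => f a * g b).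
Proof.
split=> [b c a a'|a c b b'] /=.
  by rewrite linearP mulrDl scalerAl.
by rewrite linearP mulrDr scalerAr.
Qed.
Definition mul2 : {linear talg A B -> R} :=
  mklin (tensor_lift_linear (mkbil mul2_bilinear)).
Lemma mul2_pure a b : mul2 (tpure a b) = f a * g b.
Proof. rewrite mklinE; exact: tensor_lift_pure. Qed.

End AlgebraMorphisms.

Section Copair.
Variables (k : fieldType) (A B R : comAlgType k).
Variables (f : {lrmorphism A -> R}) (g : {lrmorphism B -> R}).

Fact copair_monoid : monoid_morphism (mul2 f g).
Proof.
split=> [|t u]; first by rewrite -tpure11 mul2_pure !rmorph1 mulr1.
elim/talg_ind: t u => [u|t t' IH IH' u|a b].
- by rewrite mul0r linear0 mul0r.
- by rewrite mulrDl !linearD /= IH IH' mulrDl.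
elim/talg_ind=> [|t t' IH IH'|a' b'].
- by rewrite mulr0 linear0 mulr0.
- by rewrite mulrDr !linearD /= IH IH' mulrDr.
by rewrite tpureM !mul2_pure !rmorphM mulrACA.
Qed.

Fact mul2_linear : linear (mul2 f g). Proof. exact: linearP. Qed.
Definition copair : {lrmorphism talg A B -> R} :=
  mkalg mul2_linear copair_monoid.

Lemma copairE t : copair t = mul2 f g t. Proof. exact: mkalgE. Qed.

Lemma copair_pure a b : copair (tpure a b) = f a * g b.
Proof. by rewrite mkalgE mul2_pure. Qed.

Lemma copair_inj1 : copair \o @inj1 k A B = f :> {lrmorphism A -> R}.
Proof. by apply: lrmorphism_eq => a; rewrite /= inj1E copair_pure rmorph1 mulr1. Qed.

Lemma copair_inj2 : copair \o @inj2 k A B = g :> {lrmorphism B -> R}.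
Proof. by apply: lrmorphism_eq => a; rewrite /= inj2E copair_pure rmorph1 mul1r. Qed.

End Copair.

Section PolynomialEvaluation.
Variables (k : fieldType) (R : comAlgType k) (a : R).

Fact peval_key : {g : {lrmorphism {poly k} -> R} | g 'X = a}.
Proof. by exists (Ga_point a); exact: Ga_pointX. Qed.
Definition peval : {lrmorphism {poly k} -> R} := sval peval_key.

Lemma pevalX : peval 'X = a. Proof. exact: svalP peval_key. Qed.

Lemma peval_poly n (c : nat -> k) :
  peval (\poly_(i < n) c i) = \sum_(i < n) c i *: a ^+ i.
Proof.
rewrite poly_def linear_sum; apply: eq_bigr => i _.
by rewrite linearZ /= rmorphXn /= pevalX.
Qed.

Lemma peval_XsubC z : peval ('X - z%:P) = a - z%:A.
Proof. by rewrite rmorphB /= pevalX -alg_polyC linearZ /= rmorph1. Qed.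

End PolynomialEvaluation.

(** * Convolution *)

Lemma linear_eq (k : fieldType) (V U : lmodType k) (f g : {linear V -> U}) :
  f =1 g -> f = g.
Proof.
case: f g => [f [[fD] [fZ]]] [g [[gD] [gZ]]] /= /funext efg.
rewrite /= in efg; subst g.
by rewrite (Prop_irrelevance fD gD) (Prop_irrelevance fZ gZ).
Qed.

Section Scalars.
Variables (k : fieldType) (R : comAlgType k).
Fact scal_linear : linear (fun c : k^o => c%:A : R).
Proof. by move=> c a b; rewrite scalerDl scalerA. Qed.
Fact scal_monoid : monoid_morphism (fun c : k^o => c%:A : R).
Proof. by split=> [|a b]; rewrite ?scale1r // -scalerAl mul1r scalerA. Qed.
Definition scal : {lrmorphism k^o -> R} := mkalg scal_linear scal_monoid.
End Scalars.

Section Comultiplication.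
Variables (k : fieldType) (A : comAlgType k) (G : group_law (Spec A)).
Implicit Types R S : comAlgType k.

Fact comul_key : {D : {lrmorphism A -> talg A A} |
  D = gmul G (@inj1 k A A : Spec A _) (@inj2 k A A)}.
Proof. by eexists. Qed.
Definition comul : {lrmorphism A -> talg A A} := sval comul_key.

Fact counit_key : {e : {lrmorphism A -> k^o} | e = gone G k^o}.
Proof. by eexists. Qed.
Definition counit : {lrmorphism A -> k^o} := sval counit_key.

(** Yoneda: [copair g h] carries the universal pair of points of A (x) A to the pair (g, h). *)
Lemma gmulE R (g h : Spec A R) a : gmul G g h a = mul2 g h (comul a).
Proof.
have := gmul_nat G (copair g h) (@inj1 k A A : Spec A _) (@inj2 k A A).
rewrite /= copair_inj1 copair_inj2 => <-.
by rewrite /comul (svalP comul_key); exact: copairE.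
Qed.

Lemma gone_unique R (x : Spec A R) : gmul G x x = x -> x = gone G R.
Proof.
by move=> xx; rewrite -(gmulVg G x) -[X in gmul G _ X]xx gmulA gmulVg gmul1g.
Qed.

Lemma fmap_gone R S (f : {lrmorphism R -> S}) :
  fmap f (gone G R : Spec A R) = gone G S.
Proof. by apply: gone_unique; rewrite -gmul_nat gmul1g. Qed.

Lemma goneE R a : gone G R a = (counit a : k)%:A.
Proof. by rewrite -(fmap_gone (scal R)) /= mkalgE /counit (svalP counit_key). Qed.

Lemma mul2_comul_eq R S (f g : {linear A -> R}) (L : {linear R -> S})
    (f' g' : {linear A -> S}) (a : A) :
  (forall x y, L (f x * g y) = f' x * g' y) ->
  L (mul2 f g (comul a)) = mul2 f' g' (comul a).
Proof.
move=> e; elim/talg_ind: (comul a) => [|t u IH IH'|x y].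
- by rewrite !linear0.
- by rewrite !linearD IH IH'.
- by rewrite !mul2_pure.
Qed.

Definition mulc R (f g : {linear A -> R}) : {linear A -> R} :=
  mul2 f g \o comul.

Lemma mulcE R (f g : {linear A -> R}) a : mulc f g a = mul2 f g (comul a).
Proof. by []. Qed.

Lemma mulcA R : associative (@mulc R).
Proof.
move=> f g h; apply: linear_eq => a.
(* The maps f, g, h are only linear, not points: associativity of the law is used at the universal
   triple over [T] and carried to [R] by the linear map [L]. *)
pose T := talg (talg A A) A.
pose j1 : Spec A T := @inj1 k (talg A A) A \o @inj1 k A A.
pose j2 : Spec A T := @inj1 k (talg A A) A \o @inj2 k A A.
pose j3 : Spec A T := @inj2 k (talg A A) A.
pose L : {linear T -> R} := mul2 (mul2 f g) h.
have Lj x y z : L (j1 x * (j2 y * j3 z)) = f x * g y * h z.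
  by rewrite mulrA /= !(inj1E, inj2E) !tpureM !mulr1 !mul1r /L !mul2_pure.
have <- : L (gmul G j1 (gmul G j2 j3) a) = mulc f (mulc g h) a.
  rewrite gmulE mulcE; apply: mul2_comul_eq => x y; rewrite /= gmulE /=.
  elim/talg_ind: (comul y) => [|t u IH IH'|y' z].
  - by rewrite !linear0 !mulr0 linear0.
  - by rewrite !linearD !mulrDr linearD IH IH'.
  - by rewrite !mul2_pure Lj mulrA.
have <- : L (gmul G (gmul G j1 j2) j3 a) = mulc (mulc f g) h a.
  rewrite gmulE mulcE; apply: mul2_comul_eq => x z; rewrite /= gmulE /=.
  elim/talg_ind: (comul x) => [|t u IH IH'|x' y].
  - by rewrite !linear0 !mul0r linear0.
  - by rewrite !linearD !mulrDl linearD IH IH'.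
  - by rewrite !mul2_pure -mulrA Lj.
by rewrite gmulA.
Qed.

Definition onec R : {linear A -> R} := gone G R.

Lemma mul1c R : left_id (onec R) (@mulc R).
Proof.
move=> f; apply: linear_eq => a.
(* At the identity point the unit law is the counit identity. *)
have := congr1 (fun x : Spec A A => f (x a)) (gmul1g G (idfun : Spec A A)).
rewrite /= gmulE => <-; apply/esym/mul2_comul_eq => x y.
by rewrite /onec /= goneE mulr_algl goneE mulr_algl linearZ_LR.
Qed.

Lemma mulcDl R (f g h s : {linear A -> R}) a : (forall x, s x = f x + g x) ->
  mulc s h a = mulc f h a + mulc g h a.
Proof.
move=> e; rewrite !mulcE; elim/talg_ind: (comul a) => [|t u IH IH'|x y].
- by rewrite !linear0 addr0.
- by rewrite !linearD IH IH' addrACA.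
- by rewrite !mul2_pure e mulrDl.
Qed.

Lemma onec_neq0 R : exists a, onec R a <> 0.
Proof. by exists 1; rewrite rmorph1; apply/eqP/oner_neq0. Qed.

Lemma mulcC R : commutative_law G -> commutative (@mulc R).
Proof.
move=> cG f g; apply: linear_eq => a.
pose i1 : Spec A (talg A A) := @inj1 k A A.
pose i2 : Spec A (talg A A) := @inj2 k A A.
have <- : mul2 f g (gmul G i1 i2 a) = mulc f g a.
  rewrite gmulE mulcE; apply: mul2_comul_eq => x y.
  by rewrite /= inj1E inj2E tpureM mulr1 mul1r mul2_pure.
have <- : mul2 f g (gmul G i2 i1 a) = mulc g f a.
  rewrite gmulE mulcE; apply: mul2_comul_eq => x y.
  by rewrite /= inj1E inj2E tpureM mulr1 mul1r mul2_pure mulrC.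
by rewrite cG.
Qed.

End Comultiplication.

Section Convolution.
Variables (k : fieldType) (A : comAlgType k) (G : group_law (Spec A)).
Variables (cG : commutative_law G) (R : comAlgType k).

(* The dummy argument makes the ring structure on linear maps depend on G. *)
Definition conv (_ : commutative_law G) := {linear A -> R}.
Local Notation H := (conv cG).
HB.instance Definition _ := gen_eqMixin H.
HB.instance Definition _ := gen_choiceMixin H.

Definition conv_val (f : H) : {linear A -> R} := f.
Coercion conv_val : conv >-> GRing.Linear.type.
Definition toconv (f : {linear A -> R}) : H := f.

Lemma conv_eq (f g : H) : f =1 g -> f = g.
Proof. exact: linear_eq. Qed.

Definition lin0 : {linear A -> R} := \0.
Definition lin_add (f g : {linear A -> R}) : {linear A -> R} := f \+ g.
Definition lin_opp (f : {linear A -> R}) : {linear A -> R} := \- f.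
Definition lin_scale c (f : {linear A -> R}) : {linear A -> R} := c \*: f.

Definition conv_zero : H := mklin (linearP lin0).
Definition conv_add (f g : H) : H := mklin (linearP (lin_add f g)).
Definition conv_opp (f : H) : H := mklin (linearP (lin_opp f)).
Definition conv_scale (c : k) (f : H) : H := mklin (linearP (lin_scale c f)).
Definition conv_mul (f g : H) : H := mulc G f g.
Definition conv_one : H := onec G R.

Fact conv_addA : associative conv_add.
Proof. by move=> f g h; apply: conv_eq => a; rewrite !mklinE /= ?mklinE /= addrA. Qed.
Fact conv_addC : commutative conv_add.
Proof. by move=> f g; apply: conv_eq => a; rewrite !mklinE /= ?mklinE /= addrC. Qed.
Fact conv_add0 : left_id conv_zero conv_add.
Proof. by move=> f; apply: conv_eq => a; rewrite !mklinE /= ?mklinE /= add0r. Qed.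
Fact conv_addN : left_inverse conv_zero conv_opp conv_add.
Proof. by move=> f; apply: conv_eq => a; rewrite !mklinE /= ?mklinE /= addNr. Qed.
HB.instance Definition _ := GRing.isZmodule.Build H
  conv_addA conv_addC conv_add0 conv_addN.

Fact conv_scaleA a b f : conv_scale a (conv_scale b f) = conv_scale (a * b) f.
Proof. by apply: conv_eq => x; rewrite !mklinE /= ?mklinE /= scalerA. Qed.
Fact conv_scale1 : left_id 1 conv_scale.
Proof. by move=> f; apply: conv_eq => x; rewrite !mklinE /= ?mklinE /= scale1r. Qed.
Fact conv_scaleDr : right_distributive conv_scale +%R.
Proof. by move=> a f g; apply: conv_eq => x; rewrite !mklinE /= ?mklinE /= scalerDr. Qed.
Fact conv_scaleDl f : {morph conv_scale^~ f : a b / a + b}.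
Proof. by move=> a b; apply: conv_eq => x; rewrite !mklinE /= ?mklinE /= scalerDl. Qed.
HB.instance Definition _ := GRing.Zmodule_isLmodule.Build k H
  conv_scaleA conv_scale1 conv_scaleDr conv_scaleDl.

Fact conv_mulA : associative conv_mul. Proof. exact: mulcA. Qed.
Fact conv_mulC : commutative conv_mul. Proof. exact: mulcC. Qed.
Fact conv_mul1 : left_id conv_one conv_mul. Proof. exact: mul1c. Qed.
Fact conv_mulDl : left_distributive conv_mul +%R. Proof.
move=> f g h; apply: conv_eq => a; rewrite mklinE /=.
by apply: mulcDl => x; exact: mklinE.
Qed.
Fact conv_one_neq0 : conv_one != 0.
Proof.
have [a a0] := onec_neq0 G R; apply/eqP => e; apply: a0.
by rewrite -/conv_one e mklinE.
Qed.
HB.instance Definition _ := GRing.Zmodule_isComNzRing.Build H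
  conv_mulA conv_mulC conv_mul1 conv_mulDl conv_one_neq0.

Fact conv_scaleAl c (f g : H) : c *: (f * g) = (c *: f) * g.
Proof.
apply: conv_eq => a; rewrite mklinE /= [X in _ *: X]mulcE [RHS]mulcE.
elim/talg_ind: (comul G a) => [|t u IH IH'|x y].
- by rewrite !linear0 ?scaler0.
- by rewrite [mul2 _ _ _]linearD scalerDr IH IH' [RHS]linearD.
- by rewrite !mul2_pure mklinE /= scalerAl.
Qed.
HB.instance Definition _ := GRing.Lmodule_isLalgebra.Build k H conv_scaleAl.
HB.instance Definition _ := GRing.Lalgebra_isComAlgebra.Build k H.

Lemma convD (f g : H) a : (f + g) a = f a + g a. Proof. exact: mklinE. Qed.
Lemma convN (f : H) a : (- f) a = - f a. Proof. exact: mklinE. Qed.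
Lemma convB (f g : H) a : (f - g) a = f a - g a.
Proof. by rewrite convD convN. Qed.
Lemma convZ c (f : H) a : (c *: f) a = c *: f a. Proof. exact: mklinE. Qed.
Lemma conv0 a : (0 : H) a = 0. Proof. exact: mklinE. Qed.
Lemma conv1 a : (1 : H) a = (counit G a : k)%:A. Proof. exact: goneE. Qed.
Lemma convM (f g : H) a : (f * g) a = mul2 f g (comul G a). Proof. by []. Qed.
Lemma conv_sum (I : Type) (r : seq I) (P : pred I) (F : I -> H) a :
  (\sum_(i <- r | P i) F i) a = \sum_(i <- r | P i) F i a.
Proof.
by elim/big_rec2: _ => [|i _ y _ <-]; [exact: conv0 | exact: convD].
Qed.

End Convolution.

(** * Translation operators *)

Section Translations.
Variables (k : fieldType) (A : comAlgType k) (G : group_law (Spec A)).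
Variable cG : commutative_law G.
Implicit Types R S : comAlgType k.
Local Notation H R := (conv R cG).
Local Notation Delta := (comul G).

Lemma comp_linear R S (g : {linear R -> S}) (f : {linear A -> R}) :
  linear (fun a => g (f a)).
Proof. by move=> c a b; rewrite !linearP. Qed.

Definition push R S (g : {lrmorphism R -> S}) (f : H R) : H S :=
  mklin (comp_linear g f).

Lemma pushE R S (g : {lrmorphism R -> S}) (f : H R) a : push g f a = g (f a).
Proof. exact: mklinE. Qed.

Lemma pushM R S (g : {lrmorphism R -> S}) (f f' : H R) :
  push g (f * f') = push g f * push g f'.
Proof.
apply: conv_eq => a; rewrite pushE !convM.
by apply: mul2_comul_eq => x y; rewrite rmorphM !pushE.
Qed.

Lemma push1 R S (g : {lrmorphism R -> S}) : push g (1 : H R) = 1.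
Proof. by apply: conv_eq => a; rewrite pushE !conv1 linearZ rmorph1. Qed.

Lemma pushX R S (g : {lrmorphism R -> S}) (f : H R) n :
  push g (f ^+ n) = push g f ^+ n.
Proof. by elim: n => [|n IH]; rewrite ?push1 // !exprS pushM IH. Qed.

Definition base R (phi : H k^o) : H R := push (scal R) phi.

Lemma baseE R phi a : base R phi a = (phi a : k)%:A.
Proof. by rewrite pushE mkalgE. Qed.

Definition idc : H A := toconv cG (idfun : {linear A -> A}).

Definition trans (phi : H k^o) : H A := base A phi * idc.

(** The dictionary between operators and convolution: evaluating after a translation is multiplying
    by [phi] in the commutative ring [H R]. *)
Lemma conv_trans R (f : H R) phi a : f (trans phi a) = (base R phi * f) a.
Proof.
by rewrite !convM; apply: mul2_comul_eq => x y; rewrite !baseE !mulr_algl linearZ.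
Qed.

Lemma transM phi psi a : trans phi (trans psi a) = trans (psi * phi) a.
Proof. by rewrite conv_trans mulrA -pushM. Qed.

Lemma transC phi psi a : trans phi (trans psi a) = trans psi (trans phi a).
Proof. by rewrite !transM mulrC. Qed.

Lemma trans1 a : trans 1 a = a.
Proof. by rewrite /trans /base push1 mul1r. Qed.

Lemma transD phi psi a : trans (phi + psi) a = trans phi a + trans psi a.
Proof.
rewrite -convD -mulrDl; congr (conv_val (_ * _) a).
by apply: conv_eq => x; rewrite convD !baseE convD scalerDl.
Qed.

Lemma transZ c phi a : trans (c *: phi) a = c *: trans phi a.
Proof.
rewrite -convZ scalerAl; congr (conv_val (_ * _) a).
by apply: conv_eq => x; rewrite convZ !baseE convZ scalerA.
Qed.

Lemma transB phi psi a : trans (phi - psi) a = trans phi a - trans psi a.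
Proof. by rewrite -[- psi]scaleN1r transD transZ scaleN1r. Qed.

Lemma trans_contract (phi : {linear A -> k^o}) a :
  trans phi a = contract A phi (Delta a).
Proof.
rewrite convM; elim/talg_ind: (Delta a) => [|t u IH IH'|x y].
- by rewrite !linear0.
- by rewrite linearD IH IH' [RHS]linearD.
- by rewrite mul2_pure contract_pure baseE mulr_algl.
Qed.

(** The right factors of [Delta a] can be chosen among the translates of [a]; this is the source of
    local finiteness. *)
Lemma comul_expand a : exists s : seq (A * H k^o),
  Delta a = \sum_(z <- s) tpure z.1 (trans z.2 a).
Proof.
have [s e] := tensor_expand (Delta a); exists s; rewrite [LHS]e.
by apply: eq_bigr => z _; rewrite trans_contract.
Qed.

Definition rtrans phi : {linear talg A A -> talg A A} :=
  mul2 (@inj1 k A A) (mklin (comp_linear (@inj2 k A A) (trans phi))).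

Lemma rtrans_pure phi x y : rtrans phi (tpure x y) = tpure x (trans phi y).
Proof.
by rewrite mul2_pure mklinE /= inj1E inj2E tpureM mulr1 mul1r.
Qed.

Lemma comul_convE : toconv cG Delta =
  toconv cG (@inj1 k A A) * toconv cG (@inj2 k A A).
Proof.
apply: conv_eq => a; rewrite convM /=.
elim/talg_ind: (Delta a) => [|t u IH IH'|x y].
- by rewrite linear0.
- by rewrite linearD -IH -IH'.
- by rewrite mul2_pure /= inj1E inj2E tpureM mulr1 mul1r.
Qed.

(** With [Delta] written as the convolution product of the two injections, commutativity moves
    [base phi] past the first one, and it acts on the second. *)
Lemma comul_trans phi a : Delta (trans phi a) = rtrans phi (Delta a).
Proof.
have := conv_trans (toconv cG Delta) phi a.
rewrite comul_convE mulrCA -comul_convE => ->.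
rewrite convM; congr (mul2 _ _ _).
by apply: linear_eq => x; rewrite mklinE -conv_trans.
Qed.

End Translations.

(** * Components of the regular representation *)

Section Components.
Variables (k : fieldType) (A : comAlgType k) (G : group_law (Spec A)).
Variable cG : commutative_law G.
Implicit Types R S : comAlgType k.
Local Notation H R := (conv R cG).
Local Notation Delta := (comul G).

Definition grouplike (x : A) := Delta x = tpure x x /\ (counit G x : k) = 1.

Lemma grouplike1 : grouplike 1.
Proof. by split; rewrite rmorph1. Qed.

Lemma grouplikeM x y : grouplike x -> grouplike y -> grouplike (x * y).
Proof.
move=> [dx ex] [dy ey]; split; first by rewrite rmorphM /= dx dy tpureM.
by rewrite rmorphM /= ex ey; exact: mulr1.
Qed.

Lemma conv_grouplike R (f g : H R) x : grouplike x -> (f * g) x = f x * g x.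
Proof. by move=> [dx _]; rewrite convM dx mul2_pure. Qed.

Lemma conv1_grouplike R x : grouplike x -> (1 : H R) x = 1.
Proof. by move=> [_ ex]; rewrite conv1 ex scale1r. Qed.

Lemma convX_grouplike R (f : H R) n x : grouplike x -> (f ^+ n) x = f x ^+ n.
Proof.
move=> gx; elim: n => [|n IH]; first exact: conv1_grouplike.
by rewrite !exprS conv_grouplike // IH.
Qed.

Definition right_in (W : A -> Prop) (t : talg A A) :=
  exists2 s : seq (A * A), {in s, forall z, W z.2}
    & t = \sum_(z <- s) tpure z.1 z.2.

Lemma right_in0 W : right_in W 0.
Proof. by exists [::]; rewrite ?big_nil. Qed.

Lemma right_in_pure (W : A -> Prop) x y : W y -> right_in W (tpure x y).
Proof.
by move=> Wy; exists [:: (x, y)]; rewrite ?big_seq1 // => z /[!inE]/eqP->.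
Qed.

Lemma right_inD W t u : right_in W t -> right_in W u -> right_in W (t + u).
Proof.
move=> [s Ws ->] [s' Ws' ->]; exists (s ++ s'); rewrite ?big_cat // => z.
by rewrite mem_cat => /orP[/Ws|/Ws'].
Qed.

Lemma right_in_sum W (I : eqType) (r : seq I) (F : I -> talg A A) :
  {in r, forall i, right_in W (F i)} -> right_in W (\sum_(i <- r) F i).
Proof.
move=> FW; rewrite big_seq; elim/big_ind: _ => //; first exact: right_in0.
exact: right_inD.
Qed.

Lemma right_in_map (W W' : A -> Prop) (f : {linear talg A A -> talg A A}) t :
  (forall x y, W y -> right_in W' (f (tpure x y))) ->
  right_in W t -> right_in W' (f t).
Proof.
move=> WW' [s Ws ->]; rewrite linear_sum; apply: right_in_sum => z /Ws.
exact: WW'.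
Qed.

Lemma right_inM (W W' W'' : A -> Prop) t u :
  (forall x y, W x -> W' y -> W'' (x * y)) ->
  right_in W t -> right_in W' u -> right_in W'' (t * u).
Proof.
move=> WM [s Ws ->] [s' Ws' ->]; rewrite mulr_suml; apply: right_in_sum => z zs.
rewrite mulr_sumr; apply: right_in_sum => z' zs'; rewrite tpureM.
by apply: right_in_pure; apply: WM; [apply: Ws | apply: Ws'].
Qed.

Lemma right_in_sub (W W' : A -> Prop) t :
  (forall x, W x -> W' x) -> right_in W t -> right_in W' t.
Proof. by move=> WW' [s Ws ->]; exists s => // z /Ws/WW'. Qed.

(* The union of the layers of x is the generalized eigenspace of the
   translations for the eigenvalues phi x. *)
Fixpoint layer (x : A) (n : nat) (a : A) : Prop :=
  if n is n'.+1 then right_in (layer x n') (Delta a - tpure x a) else a = 0.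

Lemma layer0 x n : layer x n 0.
Proof.
case: n => //= n; rewrite linear0 tpure0r subr0; exact: right_in0.
Qed.

Lemma layerD x n a b : layer x n a -> layer x n b -> layer x n (a + b).
Proof.
case: n => [->->|n]; rewrite /= ?addr0 // => la lb.
by rewrite linearD tpureDr opprD addrACA; exact: right_inD.
Qed.

Lemma layerZ x n c a : layer x n a -> layer x n (c *: a).
Proof.
elim: n a => [a ->|n IH a /=]; first exact: scaler0.
rewrite linearZ tpureZr -scalerBr => -[s Ws ->].
rewrite scaler_sumr; apply: right_in_sum => z zs.
by rewrite -tpureZr; apply: right_in_pure; apply: IH; exact: Ws.
Qed.

Lemma layer_mono x n m a : (n <= m)%N -> layer x n a -> layer x m a.
Proof.
elim: n m a => [m a _ ->|n IH [//|m] a nm /=]; first exact: layer0.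
by apply: right_in_sub => y; exact: IH.
Qed.

Lemma layer_trans x n (phi : H k^o) a : layer x n a -> layer x n (trans phi a).
Proof.
elim: n a => [a ->|n IH a /= la]; first by rewrite linear0.
rewrite comul_trans -rtrans_pure -linearB.
by apply: right_in_map la => y z lz; rewrite rtrans_pure;
  apply: right_in_pure; exact: IH.
Qed.

Lemma layer_grouplike x : grouplike x -> layer x 1 x.
Proof. by move=> [/= -> _]; rewrite subrr; exact: right_in0. Qed.

(** Induction on the sum of the indices: Delta(ab) - xy (x) ab splits into three products, each with
    at least one factor whose layer has dropped. *)
Lemma layerM x y n m a b :
  layer x n a -> layer y m b -> layer (x * y) (n + m) (a * b).
Proof.
have [N nmN] := ubnP (n + m).
elim: N n m nmN a b => // N IH [|n] [|m] nmN a b.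
- by move=> -> _; rewrite mul0r; exact: layer0.
- by move=> -> _; rewrite mul0r; exact: layer0.
- by move=> _ ->; rewrite mulr0; exact: layer0.
move=> la lb; rewrite addSn /=.
have -> : Delta (a * b) - tpure (x * y) (a * b) =
  (Delta a - tpure x a) * (Delta b - tpure y b) +
  (Delta a - tpure x a) * tpure y b + tpure x a * (Delta b - tpure y b).
  rewrite rmorphM -tpureM /=; ring.
have lb' : right_in (layer y m.+1) (tpure y b) by exact: right_in_pure.
have la' : right_in (layer x n.+1) (tpure x a) by exact: right_in_pure.
rewrite addSn addnS !ltnS in nmN.
apply: right_inD; first apply: right_inD.
- apply: right_inM la lb => u v lu lv.
  by rewrite addnS; apply: (layer_mono (leqnSn _)); apply: IH => //; exact: ltnW.
- by apply: right_inM la lb' => u v lu lv; apply: IH; rewrite ?addnS.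
- by apply: right_inM la' lb => u v lu lv; rewrite addnS -addSn; apply: IH;
    rewrite ?addSn.
Qed.

(** One factor [f] kills the part x (x) a of [Delta a] and leaves right factors one layer lower;
    after n factors only zero is left. *)
Lemma layer_conv R x n a (f h : H R) : f x = 0 -> layer x n a ->
  (f ^+ n * h) a = 0.
Proof.
move=> fx; elim: n a => [a ->|n IH a [s Ws e]]; first by rewrite linear0.
rewrite exprS -mulrA convM -(subrK (tpure x a) (Delta a)) e.
rewrite linearD /= mul2_pure fx mul0r addr0 linear_sum big_seq big1 // => z zs.
by rewrite mul2_pure (IH _ (Ws z zs)) mulr0.
Qed.

Lemma layer_convX R x n m a (f : H R) : f x = 0 -> (n <= m)%N -> layer x n a ->
  (f ^+ m) a = 0.
Proof.
by move=> fx nm la; rewrite -[f ^+ m]mulr1; apply: layer_conv fx _;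
  exact: layer_mono la.
Qed.

Definition component x a := exists n, layer x n a.

Lemma component0 x : component x 0. Proof. by exists 0. Qed.

Lemma componentD x a b : component x a -> component x b -> component x (a + b).
Proof.
move=> [n la] [m lb]; exists (maxn n m); apply: layerD.
  by apply: layer_mono la; exact: leq_maxl.
by apply: layer_mono lb; exact: leq_maxr.
Qed.

Lemma component_sum x (I : eqType) (r : seq I) (F : I -> A) :
  {in r, forall i, component x (F i)} -> component x (\sum_(i <- r) F i).
Proof.
move=> FW; rewrite big_seq; elim/big_ind: _ => //; first exact: component0.
exact: componentD.
Qed.

Lemma component_trans x (phi : H k^o) a :
  component x a -> component x (trans phi a).
Proof. by case=> n la; exists n; exact: layer_trans. Qed.

Lemma componentM x y a b :
  component x a -> component y b -> component (x * y) (a * b).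
Proof. by move=> [n la] [m lb]; exists (n + m)%N; exact: layerM. Qed.

Lemma component_grouplike x : grouplike x -> component x x.
Proof. by move=> gx; exists 1; exact: layer_grouplike. Qed.

Lemma grouplike_separation x y : grouplike x -> grouplike y -> x != y ->
  exists phi : H k^o, phi x = 0 /\ phi y = 1.
Proof.
move=> gx gy xy; have := functional_separates (V := A) (v := y - x).
rewrite subr_eq0 eq_sym => /(_ xy) [f fxy].
(* The counit is 1 at group-like elements, so this multiple of it makes [phi] vanish at [x]. *)
pose f' : H k^o := toconv cG f; pose phi := f' - (f x : k) *: 1.
have fE z : grouplike z -> phi z = f z - f x.
  by move=> gz; rewrite convB convZ conv1_grouplike //; congr (_ - _); exact: mulr1.
exists (((f y - f x) : k)^-1 *: phi); rewrite !convZ !fE // subrr scaler0.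
split=> //; apply: mulVf; by rewrite linearB in fxy.
Qed.

(* theta is a product of powers of functionals that vanish at one of the other
   group-like elements and take the value 1 at x. *)
Lemma component_killer x (l : seq (A * A)) : grouplike x ->
  {in l, forall z, grouplike z.1 /\ component z.1 z.2} ->
  exists2 theta : H k^o, theta x = 1 &
    {in l, forall z, z.1 != x -> trans theta z.2 = 0}.
Proof.
move=> gx; elim: l => [_|[y w] l IH lP].
  by exists 1 => //; rewrite conv1_grouplike.
have [|theta tx tl] := IH; first by move=> z zl; apply: lP; rewrite inE zl orbT.
have [gy [n lw]] := lP (y, w) (mem_head _ _).
have [e|yx] := eqVneq y x.
  by exists theta => // z; rewrite inE => /predU1P[-> /=|/tl //]; rewrite e eqxx.
have [phi [py px]] := grouplike_separation gy gx yx.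
exists (phi ^+ n * theta).
  by rewrite conv_grouplike // convX_grouplike // px expr1n mul1r tx.
move=> z; rewrite inE => /predU1P[-> _|zl zx]; last first.
  by rewrite -transM transC (tl z zl zx) linear0.
rewrite /trans /base pushM pushX [_ * idc cG](esym (mulrA _ _ _)); apply: layer_conv lw.
by rewrite baseE py scale0r.
Qed.

Lemma component_faithful x b (theta : H k^o) :
  grouplike x -> component x b -> theta x = 1 -> trans theta b = 0 -> b = 0.
Proof.
move=> gx [n lb] tx tb; pose t := base A theta.
(* On the component of [x] the operator of [theta] has eigenvalue 1; since (1 - t)^n kills [b], this
   identity exhibits an inverse of [t] up to sign. *)
have [q tq] : exists q, (1 - t) ^+ n = 1 + t * q.
  elim: n {lb} => [|n [q IH]]; first by exists 0; rewrite mulr0 addr0.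
  by exists (q * (1 - t) - 1); rewrite exprSr IH; ring.
have : ((1 - t) ^+ n * idc cG) b = 0.
  by apply: layer_conv lb; rewrite convB conv1_grouplike // baseE tx scale1r subrr.
by rewrite tq mulrDl mul1r convD -mulrA -conv_trans tb linear0 addr0.
Qed.

Definition homogeneous (l : seq (A * A)) :=
  {in l, forall z, grouplike z.1 /\ component z.1 z.2}.

(** The directness of the sum of components, in the form that makes the retraction well defined.
    Labels may repeat, so all entries sharing the label of the head are summed and removed
    together. *)
Lemma homogeneous_relation l : homogeneous l -> \sum_(z <- l) z.2 = 0 ->
  \sum_(z <- l) (counit G z.2 : k) *: z.1 = 0.
Proof.
have [n] := ubnP (size l); elim: n l => // n IH [|[x a] l0] ln hl l0E.
  by rewrite big_nil.
set l := (x, a) :: l0 in ln hl l0E *.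
have [gx _] := hl (x, a) (mem_head _ _).
pose l' := [seq z <- l | z.1 != x].
pose b := \sum_(z <- l | z.1 == x) z.2.
have cb : component x b.
  rewrite /b -big_filter; apply: component_sum => z.
  by rewrite mem_filter => /andP[/eqP<- /hl[]].
have sb : b + \sum_(z <- l') z.2 = 0.
  by rewrite big_filter -[RHS]l0E [RHS](bigID (fun z => z.1 == x)).
have [theta tx tl] := component_killer gx hl.
have b0 : b = 0.
  apply: (component_faithful gx cb tx).
  rewrite -[RHS](linear0 (trans theta)) -sb linearD.
  rewrite [X in _ + X]linear_sum big_seq big1 ?addr0 // => z.
  by rewrite mem_filter => /andP[zx zl]; exact: tl.
have hl' : homogeneous l' by move=> z; rewrite mem_filter => /andP[_ /hl].
have {IH} : \sum_(z <- l') (counit G z.2 : k) *: z.1 = 0.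
  apply: IH => //; last by rewrite -[LHS]add0r -[X in X + _]b0.
  rewrite /l' /= eqxx size_filter; apply: leq_ltn_trans (count_size _ _) _.
  exact: ln.
rewrite big_filter => e; rewrite (bigID (fun z => z.1 == x)) /= e addr0.
transitivity ((counit G b : k) *: x); last by rewrite b0 linear0 scale0r.
by rewrite /b linear_sum scaler_suml; apply: eq_bigr => z /eqP->.
Qed.

End Components.

(** * Decomposition into components *)

Section Decomposition.
Variables (k : fieldType) (A : comAlgType k) (G : group_law (Spec A)).
Variable cG : commutative_law G.
Local Notation E := (conv k^o cG).
Local Notation Delta := (comul G).

Definition decomposable a :=
  exists2 l, homogeneous G l & a = \sum_(z <- l) z.2.

Lemma homogeneous_cat l l' :
  homogeneous G l -> homogeneous G l' -> homogeneous G (l ++ l').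
Proof. by move=> hl hl' z; rewrite mem_cat => /orP[/hl|/hl']. Qed.

Lemma decomposable0 : decomposable 0.
Proof. by exists [::]; rewrite ?big_nil. Qed.

Lemma decomposableD a b :
  decomposable a -> decomposable b -> decomposable (a + b).
Proof.
move=> [l hl ->] [l' hl' ->]; exists (l ++ l'); rewrite ?big_cat //.
exact: homogeneous_cat.
Qed.

Lemma decomposable_sum (I : eqType) (r : seq I) (F : I -> A) :
  {in r, forall i, decomposable (F i)} -> decomposable (\sum_(i <- r) F i).
Proof.
move=> FW; rewrite big_seq; elim/big_ind: _ => //; first exact: decomposable0.
exact: decomposableD.
Qed.

Lemma decomposable_component x a :
  grouplike G x -> component G x a -> decomposable a.
Proof.
move=> gx ca; exists [:: (x, a)]; rewrite ?big_seq1 // => z.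
by rewrite inE => /eqP->.
Qed.

Lemma decomposable_trans (phi : E) a :
  decomposable a -> decomposable (trans phi a).
Proof.
case=> l hl ->; rewrite linear_sum; apply: decomposable_sum => z /hl[gz cz].
by apply: decomposable_component gz _; exact: component_trans.
Qed.

Lemma decomposableZ c a : decomposable a -> decomposable (c *: a).
Proof. by move=> da; rewrite -(trans1 cG a) -transZ; exact: decomposable_trans. Qed.

Lemma decomposableN a : decomposable a -> decomposable (- a).
Proof. by move=> da; rewrite -scaleN1r; exact: decomposableZ. Qed.

Lemma decomposableB a b :
  decomposable a -> decomposable b -> decomposable (a - b).
Proof. by move=> da db; apply: decomposableD => //; exact: decomposableN. Qed.

Lemma mul2_separates (t : talg A A) :
  (forall f g : {linear A -> k^o}, mul2 f g t = 0) -> t = 0.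
Proof.
move=> t0; have [s ->] := tensor_expand (t : tensor A A).
rewrite big1 // => z _; rewrite [contract _ _ _](_ : _ = 0) ?linear0r //.
apply: functional_eq => g; rewrite linear0 -[RHS](t0 z.2 g).
elim/talg_ind: t {t0} => [|t u IH IH'|x y]; first by rewrite !linear0.
  by rewrite [contract _ _ _]linearD !linearD IH IH'.
by rewrite contract_pure mul2_pure linearZ.
Qed.

Lemma grouplike_criterion x :
  (forall f g : E, (f * g) x = f x * g x) -> counit G x = 1 :> k -> grouplike G x.
Proof.
move=> xM x1; split=> //; apply/eqP; rewrite -subr_eq0; apply/eqP.
apply: mul2_separates => f g; rewrite linearB /= mul2_pure.
by apply/eqP; rewrite subr_eq0; apply/eqP; exact: (xM f g).
Qed.

Section Expansion.
Variable s : seq (A * E).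
(** The list stays fixed while [b] varies: the elements with this expansion are stable under
    translations, and on them [trans phi] depends only on the values of [phi] at the finitely many
    [z.1]. *)
Definition expands b := Delta b = \sum_(z <- s) tpure z.1 (trans z.2 b).

Lemma expands_trans (phi : E) b : expands b -> expands (trans phi b).
Proof.
rewrite /expands comul_trans => ->; rewrite linear_sum; apply: eq_bigr => z _.
by rewrite rtrans_pure transC.
Qed.

Lemma trans_expands (phi : E) b : expands b ->
  trans phi b = \sum_(z <- s) (phi z.1 : k) *: trans z.2 b.
Proof.
rewrite trans_contract => ->; rewrite linear_sum; apply: eq_bigr => z _.
exact: contract_pure.
Qed.

Lemma annihilating_poly (phi : E) :
  exists2 p : {poly k}, p != 0 & forall b, expands b -> trans (peval phi p) b = 0.
Proof.
pose m := size s; pose x (j : 'I_m) := (tnth (in_tuple s) j).1.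
(* The powers of [phi] up to exponent m give m + 1 rows of m values, hence a linear dependence,
   whose coefficients form the polynomial. *)
pose M := \matrix_(i < m.+1, j < m) ((phi ^+ i) (x j) : k).
have kM : kermx M != 0.
  by rewrite kermx_eq0 /row_free neq_ltn (leq_ltn_trans (rank_leq_col M)).
have [v vM v0] : exists2 v : 'rV_m.+1, v *m M = 0 & v != 0.
  by have /rowV0Pn[v /sub_kermxP vM v0] := kM; exists v.
pose p := \poly_(i < m.+1) v 0 (inord i); exists p.
  apply: contraNneq v0 => p0; apply/eqP/rowP=> i.
  by have := coef_poly m.+1 (fun i => v 0 (inord i)) i;
    rewrite -/p p0 coef0 ltn_ord inord_val mxE.
move=> b eb; rewrite (trans_expands _ eb) big_tnth big1 // => j _.
rewrite [X in X *: _](_ : _ = 0) ?scale0r //.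
have /matrixP/(_ 0 j) := vM; rewrite !mxE => <-.
rewrite peval_poly conv_sum; apply: eq_bigr => i _.
by rewrite mxE convZ inord_val.
Qed.

(** The factors are applied one at a time; the last element that is still not decomposable is an
    eigenvector modulo the decomposable ones. *)
Lemma common_eigenvector1 (phi : E) (r : seq k) b : ~ decomposable b ->
  decomposable (trans (\prod_(z <- r) (phi - z *: 1)) b) ->
  exists psi : E, exists2 z : k, ~ decomposable (trans psi b) &
    decomposable (trans (phi - z *: 1) (trans psi b)).
Proof.
elim: r b => [|z r IH] b nb; first by rewrite big_nil trans1.
rewrite big_cons => db; have [dz|nz] := EM (decomposable (trans (phi - z *: 1) b)).
  by exists 1, z; rewrite trans1.
have [|psi [c n1 d1]] := IH _ nz; first by rewrite transM.
by exists ((phi - z *: 1) * psi), c; rewrite -transM.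
Qed.

End Expansion.
End Decomposition.

Section ClosedField.
Variables (k : closedFieldType) (A : comAlgType k) (G : group_law (Spec A)).
Variable cG : commutative_law G.
Local Notation E := (conv k^o cG).
Local Notation Delta := (comul G).

(** Passing to a translate [trans psi b] keeps the eigenvalues already found, because translations
    commute and preserve decomposable elements. *)
Lemma common_eigenvector (s : seq (A * E)) (a : A) (l : seq E) :
  expands s a -> ~ decomposable G a ->
  exists b, [/\ expands s b, ~ decomposable G b &
    {in l, forall phi, exists z : k, decomposable G (trans (phi - z *: 1) b)}].
Proof.
move=> ea na; elim: l => [|phi l [b [eb nb bl]]]; first by exists a.
have [p p0 pb] := annihilating_poly s phi.
have [r pr] := closed_field_poly_normal p.
have db : decomposable G (trans (\prod_(z <- r) (phi - z *: 1)) b).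
  have := pb b eb; rewrite {1}pr linearZ transZ => /eqP.
  rewrite scaler_eq0 lead_coef_eq0 (negPf p0) /= rmorph_prod => /eqP.
  rewrite (eq_bigr (fun z => phi - z *: 1)) => [->|z _]; first exact: decomposable0.
  exact: peval_XsubC.
have [psi [z nb' db']] := common_eigenvector1 nb db.
exists (trans psi b); split=> //; first exact: expands_trans.
move=> phi'; rewrite inE => /predU1P[->|/bl[z' dz']]; first by exists z.
by exists z'; rewrite transC; exact: decomposable_trans.
Qed.

(** Otherwise there is a common eigenvector modulo decomposable elements. Its eigenvalues define a
    group-like element, and a suitable translate of it lies in the corresponding component, a
    contradiction. *)
Theorem decomposition (a : A) : decomposable G a.
Proof.
apply: contrapT => na; have [s ea] := comul_expand cG a.
have [b [eb nb bl]] := common_eigenvector [seq z.2 | z <- s] ea na.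
have /choice[lam lamP] (f : E) : exists z : k,
    f \in [seq z.2 | z <- s] -> decomposable G (trans f b - z *: b).
  have [/bl[z dz]|] := boolP (f \in [seq z.2 | z <- s]); last by exists 0.
  by exists z => _; move: dz; rewrite transB transZ trans1.
have {}lamP z : z \in s -> decomposable G (trans z.2 b - lam z.2 *: b).
  by move=> zs; apply: lamP; exact: map_f.
(* Eigenvalues are known only for the functionals listed in [s]; through the expansion of [b] they
   give the eigenvalue [phi c] for every [phi]. *)
pose c := \sum_(z <- s) lam z.2 *: z.1.
have cP (phi : E) : decomposable G (trans phi b - (phi c : k) *: b).
  have -> : trans phi b - (phi c : k) *: b =
      \sum_(z <- s) (phi z.1 : k) *: (trans z.2 b - lam z.2 *: b).
    rewrite (trans_expands _ eb) /c linear_sum scaler_suml -sumrB.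
    apply: eq_bigr => z _; rewrite scalerBr scalerA; congr (_ - _ *: _).
    by rewrite linearZ mulrC.
  by apply: decomposable_sum => z zs; apply: (decomposableZ cG); exact: lamP.
have nbZ (z : k) : decomposable G (z *: b) -> z = 0.
  move=> dz; apply: contrapT => /eqP z0; apply: nb.
  by rewrite -[b]scale1r -(mulVf z0) -scalerA; exact: (decomposableZ cG).
(* Composing translations multiplies their eigenvalues on [b], so evaluation at [c] is
   multiplicative for convolution. *)
have gc : grouplike G c.
  apply: (grouplike_criterion (cG := cG)) => [f g|].
    apply/eqP; rewrite -subr_eq0; apply/eqP/nbZ.
    have d1 := decomposable_trans g (cP f).
    rewrite linearB transM linearZ_LR in d1.
    have d2 := decomposableZ cG (f c : k) (cP g).
    rewrite scalerBr scalerA in d2.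
    have := decomposableD (decomposableB cG d1 (cP (f * g))) d2.
    rewrite scalerBl; congr (decomposable _ _).
    by set u := trans _ b; set v := _ *: trans _ b; ring.
  apply/eqP; rewrite -subr_eq0 -opprB oppr_eq0; apply/eqP/nbZ.
  have := cP 1; rewrite trans1 conv1 scalerBl scale1r.
  by rewrite -[_%:A]/(_ * 1) mulr1.
have /choice[L LP] (z : A * E) : exists l, z \in s -> homogeneous G l /\
    trans z.2 b - lam z.2 *: b = \sum_(w <- l) w.2.
  by have [/lamP[l hl e]|] := boolP (z \in s); [exists l | exists [::]].
(* [theta] removes from the finitely many error terms all components other than that of [c], while
   theta(c) = 1 keeps [b'] congruent to [b] modulo decomposable elements. *)
have [theta tc tL] : exists2 theta : E, theta c = 1 &
    {in flatten [seq L z | z <- s], forall w, w.1 != c -> trans theta w.2 = 0}.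
  apply: component_killer => // w /flattenP[l /mapP[z zs ->]].
  by have [hl _] := LP z zs; exact: hl.
pose b' := trans theta b.
have nb' : ~ decomposable G b'.
  move=> db'; apply: nb; rewrite -[b](subKr b').
  by apply: (decomposableB cG) => //; have := cP theta; rewrite tc scale1r.
have eb' : expands s b' by exact: expands_trans.
have b'P z : z \in s -> component G c (trans z.2 b' - lam z.2 *: b').
  move=> zs; have [hl e] := LP z zs.
  rewrite /b' transC -linearZ_LR -linearB e linear_sum.
  apply: component_sum => w wl; have [wc|/tL ->] := eqVneq w.1 c.
  - by rewrite -wc; apply: component_trans; exact: (hl w wl).2.
  - exact: component0.
  - by apply/flattenP; exists (L z) => //; exact: map_f.
apply: nb'; apply: (decomposable_component gc).
have [n nP] : exists n, {in s, forall z, layer G c n (trans z.2 b' - lam z.2 *: b')}.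
  elim: (s) b'P => [_|z r IH rP]; first by exists 0.
  have [|n nP] := IH; first by move=> w wr; apply: rP; rewrite inE wr orbT.
  have [m mP] := rP z (mem_head _ _).
  exists (maxn n m) => w; rewrite inE => /predU1P[->|/nP].
    by apply: layer_mono mP; exact: leq_maxr.
  by apply: layer_mono; exact: leq_maxl.
(* The right factors of Delta(b') - c (x) b' are the error terms, so [b'] is one layer above
   them. *)
exists n.+1; rewrite /= eb' /c tpure_suml -sumrB.
apply: right_in_sum => z zs; rewrite tpureZl -tpureZr -tpureBr.
by apply: right_in_pure; exact: nP.
Qed.
End ClosedField.

(** * The semisimple and unipotent parts *)

Section SemisimplePart.
Variables (k : closedFieldType) (A : comAlgType k) (G : group_law (Spec A)).
Variable cG : commutative_law G.
Implicit Types R S : comAlgType k.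
Local Notation H R := (conv R cG).
Local Notation Delta := (comul G).

Lemma component_ind (P : A -> Prop) :
  P 0 -> (forall a b, P a -> P b -> P (a + b)) ->
  (forall x a, grouplike G x -> component G x a -> P a) -> forall a, P a.
Proof.
move=> P0 PD Pc a; have [l hl ->] := decomposition cG a.
rewrite big_seq; elim/big_ind: _ => // z /hl[gz cz]; exact: Pc gz cz.
Qed.

Lemma component_eq (U : lmodType k) (f g : {linear A -> U}) :
  (forall x a, grouplike G x -> component G x a -> f a = g a) -> f =1 g.
Proof.
move=> e; elim/component_ind => [|a b ea eb|x a gx ca].
- by rewrite !linear0.
- by rewrite !linearD ea eb.
- exact: e gx ca.
Qed.

(** Well defined by [homogeneous_relation]; multiplicative because the components of x and y
    multiply into that of xy and the counit is multiplicative. *)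
Fact semisimple_key : exists s : {lrmorphism A -> A},
  forall x a, grouplike G x -> component G x a -> s a = (counit G a : k) *: x.
Proof.
have /choice[l lP] a : exists l, homogeneous G l /\ a = \sum_(z <- l) z.2.
  by have [l hl e] := decomposition cG a; exists l.
pose ev (r : seq (A * A)) := \sum_(z <- r) (counit G z.2 : k) *: z.1.
pose scale c (r : seq (A * A)) := [seq (z.1, c *: z.2) | z <- r].
have hscale c r : homogeneous G r -> homogeneous G (scale c r).
  move=> hr _ /mapP[z /hr[gz [n lz]] ->]; split=> //.
  by exists n; exact: layerZ.
have evscale c r : ev (scale c r) = c *: ev r.
  rewrite /ev big_map scaler_sumr; apply: eq_bigr => z _.
  by rewrite linearZ scalerA.
have sumscale c r : \sum_(z <- scale c r) z.2 = c *: \sum_(z <- r) z.2.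
  by rewrite big_map scaler_sumr.
have evE r r' : homogeneous G r -> homogeneous G r' ->
    \sum_(z <- r) z.2 = \sum_(z <- r') z.2 -> ev r = ev r'.
  move=> hr hr' e; apply/eqP; rewrite -subr_eq0 -scaleN1r -evscale -[_ + _]big_cat.
  apply/eqP; apply: (homogeneous_relation cG).
    by apply: homogeneous_cat => //; exact: hscale.
  by rewrite big_cat sumscale scaleN1r /= e subrr.
have sL : linear (fun a => ev (l a)).
  move=> c a b; rewrite -evscale -[RHS]big_cat; apply: evE.
  - exact: (lP _).1.
  - by apply: homogeneous_cat; [apply: hscale|]; exact: (lP _).1.
  - by rewrite big_cat sumscale -!(lP _).2.
pose s := mklin sL.
have sP x a : grouplike G x -> component G x a -> s a = (counit G a : k) *: x.
  move=> gx ca; rewrite mklinE (evE _ [:: (x, a)]).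
  - by rewrite /ev big_seq1.
  - exact: (lP _).1.
  - by move=> z; rewrite inE => /eqP->.
  - by rewrite -(lP _).2 big_seq1.
have sM : monoid_morphism s.
  split=> [|a b].
    rewrite (sP 1 1) ?rmorph1 ?scale1r //; first exact: grouplike1.
    by apply: component_grouplike; exact: grouplike1.
  elim/component_ind: a b => [b|a a' ea ea' b|x a gx ca].
  - by rewrite mul0r linear0 mul0r.
  - by rewrite mulrDl !linearD ea ea' mulrDl.
  elim/component_ind => [|b b' eb eb'|y b gy cb].
  - by rewrite mulr0 linear0 mulr0.
  - by rewrite mulrDr !linearD eb eb' mulrDr.
  rewrite (sP (x * y)) ?(sP x a) ?(sP y b) //; last exact: componentM.
    by rewrite -scalerAl -scalerAr scalerA rmorphM.
  exact: grouplikeM.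
exists (mkalg (linearP s) sM) => x a gx ca; rewrite mkalgE; exact: sP.
Qed.

Definition sspart : {lrmorphism A -> A} := sval (cid semisimple_key).

Lemma sspart_component x a :
  grouplike G x -> component G x a -> sspart a = (counit G a : k) *: x.
Proof. exact: (svalP (cid semisimple_key)). Qed.

Lemma sspart_grouplike x : grouplike G x -> sspart x = x.
Proof.
move=> gx; rewrite (sspart_component gx (component_grouplike gx)).
by case: gx => _ ->; rewrite scale1r.
Qed.

Lemma sspart_idem a : sspart (sspart a) = sspart a.
Proof.
pose f : {linear A -> A} := sspart \o sspart.
suff : f =1 sspart by apply.
apply: component_eq => x b gx cb; rewrite /f /= (sspart_component gx cb).
by rewrite linearZ /= sspart_grouplike.
Qed.

Lemma component_comul x a : component G x a ->
  grouplike G x -> right_in (component G x) (Delta a).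
Proof.
move=> [[->|n la] gx]; first by rewrite linear0; exact: right_in0.
rewrite -(subrK (tpure x a) (Delta a)); apply: right_inD.
  by apply: right_in_sub la => y ly; exists n.
by apply: right_in_pure; exists n.+1.
Qed.

Definition precomp_sspart R (h : H R) : H R := mklin (comp_linear h sspart).

Lemma precomp_sspartE R (h : H R) a : precomp_sspart h a = h (sspart a).
Proof. exact: mklinE. Qed.

(** The right factors of [Delta a] stay in the component of [x], where the retraction is the counit
    times [x]; the counit law then collapses the sum. *)
Lemma conv_sspart R (f h : H R) x a : grouplike G x -> component G x a ->
  (f * precomp_sspart h) a = f a * h x.
Proof.
move=> gx ca; have [s sc e] := component_comul ca gx.
have -> : f a = (f * 1 : H R) a by rewrite mulr1.
rewrite !convM e !linear_sum mulr_suml.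
apply: eq_big_seq => z /sc cz.
rewrite !mul2_pure precomp_sspartE (sspart_component gx cz) (conv1 cG) linearZ_LR.
by rewrite -!scalerAr mulr1 -scalerAl.
Qed.

(** Compatibility of the retraction with comultiplication, stated on points: on the component of x
    both sides are eps(a) g(x) h(x). *)
Lemma sspart_gmul R (g h : Spec A R) :
  gmul G (g \o sspart : Spec A R) (h \o sspart) =
  (gmul G g h \o sspart : Spec A R).
Proof.
pose f : {linear A -> R} := gmul G g h \o sspart.
have toconvE (g' : Spec A R) :
    mklin (linearP (g' \o sspart : Spec A R)) = precomp_sspart (toconv cG g').
  by apply: linear_eq => a; rewrite mklinE precomp_sspartE.
apply: lrmorphism_eq.
suff : gmul G (g \o sspart : Spec A R) (h \o sspart) =1 f by apply.
apply: component_eq => x a gx ca; rewrite /f /= gmulE.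
rewrite (sspart_component gx ca) linearZ /= gmulE.
have [dx ex] := gx; rewrite dx mul2_pure.
have := conv_sspart (precomp_sspart (toconv cG g)) (toconv cG h) gx ca.
rewrite precomp_sspartE /= (sspart_component gx ca) linearZ -scalerAl => <-.
by congr (mul2 _ _ _); apply: linear_eq => b; rewrite precomp_sspartE.
Qed.

Definition unipart : Spec A A :=
  gmul G (idfun : Spec A A) (ginv G (sspart : Spec A A)).

Lemma gmulC R : commutative (@gmul _ _ G R). Proof. exact: cG. Qed.

Lemma gmulg1 R : right_id (gone G R) (@gmul _ _ G R).
Proof. by move=> x; rewrite gmulC gmul1g. Qed.

Lemma gmul_injr R (z x y : Spec A R) : gmul G x z = gmul G y z -> x = y.
Proof.
move=> e; rewrite -(gmulg1 x) -(gmulg1 y) -(gmulVg G z).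
by rewrite (gmulC (ginv G z)) !gmulA e.
Qed.

Lemma unipart_sspart : gmul G unipart (sspart : Spec A A) = (idfun : Spec A A).
Proof. by rewrite /unipart -gmulA gmulVg gmulg1. Qed.

Lemma point_decomposition R (g : Spec A R) :
  g = gmul G (g \o unipart : Spec A R) (g \o sspart).
Proof.
have := gmul_nat G g unipart (sspart : Spec A A).
by rewrite unipart_sspart /= => <-; apply: lrmorphism_eq.
Qed.

(** By cancellation: each point is the product of its unipotent and semisimple parts, the semisimple
    parts multiply, and the law is commutative. *)
Lemma unipart_gmul R (g h : Spec A R) :
  gmul G (g \o unipart : Spec A R) (h \o unipart) =
  (gmul G g h \o unipart : Spec A R).
Proof.
apply: (@gmul_injr _ (gmul G g h \o sspart)).
rewrite -point_decomposition -sspart_gmul.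
rewrite gmulA -(gmulA G _ (h \o unipart : Spec A R)).
rewrite (gmulC (h \o unipart : Spec A R)) gmulA -point_decomposition.
by rewrite -gmulA -point_decomposition.
Qed.

Lemma gmul_grouplike R (g h : Spec A R) x :
  grouplike G x -> gmul G g h x = g x * h x.
Proof. by move=> [dx _]; rewrite gmulE dx mul2_pure. Qed.

Lemma gone_grouplike R x : grouplike G x -> gone G R x = 1.
Proof. by move=> [_ ex]; rewrite goneE ex scale1r. Qed.

Lemma unipart_grouplike x : grouplike G x -> unipart x = 1.
Proof.
(* This reads x = u(x) x, and [x] is invertible with inverse given by the coinverse. *)
move=> gx; have := gmul_grouplike unipart sspart gx.
rewrite unipart_sspart sspart_grouplike // => /= ux.
have := gmul_grouplike (idfun : Spec A A) (ginv G (idfun : Spec A A)) gx.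
rewrite gmulC gmulVg gone_grouplike //= => xV.
by rewrite -[LHS]mulr1 xV mulrA -ux -xV.
Qed.

(** A homomorphism from G to G_a, in the form in which the additive coordinates use it. *)
Definition primitive p := forall R (g h : Spec A R), gmul G g h p = g p + h p.

Lemma primitive_comul p : primitive p -> Delta p = tpure p 1 + tpure 1 p.
Proof.
move=> pp; have := pp _ (@inj1 k A A : Spec A _) (@inj2 k A A : Spec A _).
rewrite inj1E inj2E => <-; rewrite gmulE.
have := comul_convE cG => /(congr1 (fun f : H _ => f p)).
by rewrite convM.
Qed.

Lemma primitive_component p : primitive p -> component G 1 p.
Proof.
move=> pp; exists 2%N; rewrite /= primitive_comul // addrK.
by apply: right_in_pure; rewrite /= rmorph1 subrr; exact: right_in0.
Qed.

Lemma primitive_gone R p : primitive p -> gone G R p = 0.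
Proof.
move=> pp; have := pp _ (gone G R) (gone G R); rewrite gmul1g => /eqP.
by rewrite -subr_eq0 opprD addNKr oppr_eq0 => /eqP.
Qed.

Lemma primitive_counit p : primitive p -> counit G p = 0.
Proof.
move=> /(primitive_gone k^o); rewrite goneE => e.
by rewrite -[LHS]mulr1; exact: e.
Qed.

Lemma sspart_primitive p : primitive p -> sspart p = 0.
Proof.
move=> pp; rewrite (sspart_component (grouplike1 G) (primitive_component pp)).
by rewrite primitive_counit // scale0r.
Qed.

Lemma unipart_primitive p : primitive p -> unipart p = p.
Proof.
move=> pp; have := pp _ unipart (sspart : Spec A A).
by rewrite unipart_sspart sspart_primitive // addr0.
Qed.

End SemisimplePart.

(** * Exponential and logarithm *)

Section CharacteristicZero.
Variable k : fieldType.
Hypothesis char0 : [pchar k] =i pred0.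

Lemma natk_eq0 n : (n%:R == 0 :> k) = (n == 0%N).
Proof. by move/pcharf0P: char0; apply. Qed.

Lemma mulrn_inj (V : lmodType k) n (x y : V) : x *+ n.+1 = y *+ n.+1 -> x = y.
Proof.
rewrite -!scaler_nat => /(congr1 (fun z => (n.+1%:R : k)^-1 *: z)).
by rewrite !scalerA mulVf ?natk_eq0 // !scale1r.
Qed.

Lemma poly_nat_roots (p : {poly k}) : (forall n, p.[n%:R] = 0) -> p = 0.
Proof.
move=> p0; apply/eqP; apply: contraT => pn0.
have := @max_poly_roots k p [seq n%:R | n <- iota 0 (size p)] pn0.
rewrite size_map size_iota ltnn => -> //.
  by apply/allP=> _ /mapP[n _ ->]; rewrite /root p0.
rewrite map_inj_in_uniq ?iota_uniq // => i j _ _.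
wlog ij : i j / (i <= j)%N.
  move=> W; case/orP: (leq_total i j) => [|ji e]; first exact: W.
  by apply/esym; apply: W.
move=> e; apply/eqP; rewrite eqn_leq ij /= -subn_eq0 -natk_eq0 natrB //.
by rewrite e subrr.
Qed.

(** Roots cannot be counted in [R], which may have zero divisors; the coefficients are tested by
    linear functionals with values in k. *)
Lemma poly_alg_nat_roots (R : comAlgType k) (p : {poly R}) :
  (forall n, p.[n%:R] = 0) -> p = 0.
Proof.
move=> p0; apply/polyP=> i; rewrite coef0; apply: functional_eq => f.
rewrite linear0; pose q := \poly_(j < size p) (f p`_j : k).
have q0 : q = 0.
  apply: poly_nat_roots => n; rewrite horner_poly.
  transitivity (f p.[n%:R]); last by rewrite p0 linear0.
  rewrite horner_coef linear_sum; apply: eq_bigr => j _; rewrite -!natrX.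
  by rewrite [LHS]mulr_natr [in RHS]mulr_natr raddfMn.
have [ip|ip] := ltnP i (size p); last by rewrite nth_default // linear0.
by have := coef_poly (size p) (fun j => f p`_j : k) i; rewrite -/q q0 coef0 ip.
Qed.

Lemma poly_alg_nat_eq (R : comAlgType k) (p q : {poly R}) :
  (forall n, p.[n%:R] = q.[n%:R]) -> p = q.
Proof.
move=> e; apply/eqP; rewrite -subr_eq0; apply/eqP/poly_alg_nat_roots => n.
by rewrite hornerD hornerN e subrr.
Qed.

Lemma binomial_poly n : exists p : {poly k}, forall N, p.[N%:R] = 'C(N, n)%:R.
Proof.
exists ((n`!%:R)^-1 *: \prod_(i < n) ('X - i%:R%:P)) => N.
rewrite hornerZ horner_prod (eq_bigr (fun i : 'I_n => N%:R - i%:R)); last first.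
  by move=> i _; rewrite hornerXsubC.
have -> : \prod_(i < n) (N%:R - i%:R) = (N ^_ n)%:R :> k.
  elim: n => [|n IH]; first by rewrite big_ord0.
  rewrite big_ord_recr /= IH ffactnSr natrM.
  (* Truncated subtraction agrees with subtraction in k unless N < n, and then the falling factorial
     is already zero. *)
  have [nN|Nn] := leqP n N; first by rewrite natrB.
  by rewrite ffact_small // !mul0r.
rewrite -bin_ffact natrM mulrCA mulVf ?mulr1 //.
by rewrite natk_eq0 -lt0n fact_gt0.
Qed.

End CharacteristicZero.

Lemma sum_tail0 (V : nmodType) (F : nat -> V) n m :
  (forall i, (n <= i)%N -> F i = 0) -> (n <= m)%N ->
  \sum_(i < m) F i = \sum_(i < n) F i.
Proof.
move=> F0 nm; rewrite (big_ord_widen _ _ nm) [RHS]big_mkcond /=.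
by apply: eq_bigr => i _; case: ltnP => // /F0.
Qed.

Section ExpLog.
Variables (k : closedFieldType) (A : comAlgType k) (G : group_law (Spec A)).
Variables (cG : commutative_law G) (char0 : [pchar k] =i pred0).
Implicit Types R S : comAlgType k.
Local Notation H R := (conv R cG).
Local Notation Delta := (comul G).

Lemma comul_sum a : exists s : seq (A * A), Delta a = \sum_(z <- s) tpure z.1 z.2.
Proof.
by have [s e] := comul_expand cG a; exists [seq (z.1, trans z.2 a) | z <- s];
  rewrite big_map.
Qed.

Lemma convE_sum R (f g : H R) a (s : seq (A * A)) :
  Delta a = \sum_(z <- s) tpure z.1 z.2 ->
  (f * g) a = \sum_(z <- s) f z.1 * g z.2.
Proof.
move=> e; rewrite convM e linear_sum; apply: eq_bigr => z _.
by rewrite mul2_pure.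
Qed.

(** The bound depends on [a] alone; it serves both u - eps and the derivations with values in an
    arbitrary [R]. *)
Lemma nilpotency_bound a : exists n, forall R (f : H R),
  (forall x, grouplike G x -> f x = 0) ->
  forall m, (n <= m)%N -> (f ^+ m) a = 0.
Proof.
elim/(component_ind cG): a => [|a b [n na] [m mb]|x a gx [n la]].
- by exists 0%N => R f _ m _; rewrite linear0.
- exists (maxn n m) => R f fx l; rewrite geq_max => /andP[nl ml].
  by rewrite linearD /= na // mb // addr0.
- by exists n => R f fx m nm; apply: layer_convX la; rewrite ?fx.
Qed.

Local Notation u := (toconv cG (unipart cG)).

Lemma point_conv_power R (g : Spec A R) n :
  exists v : Spec A R, forall a, v a = (toconv cG g ^+ n) a.
Proof.
elim: n => [|n [v vP]]; first by exists (gone G R).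
exists (gmul G g v) => a; rewrite exprS gmulE convM.
by congr (mul2 _ _ _); apply: linear_eq.
Qed.

Lemma power_poly a : exists p : {poly A}, forall n, p.[n%:R] = (u ^+ n) a.
Proof.
have /choice[b bP] := binomial_poly char0.
have [K KP] := nilpotency_bound a.
pose nu := u - 1.
have nu0 m : (K <= m)%N -> (nu ^+ m) a = 0.
  apply: KP => x gx.
  by rewrite convB (conv1_grouplike cG) // [toconv _ _ _]unipart_grouplike // subrr.
(* The binomial expansion of (1 + nu)^n at [a], cut at a length [K] independent of n. *)
exists (\sum_(i < K) map_poly (in_alg A) (b i) * ((nu ^+ i) a)%:P) => n.
pose F i := (nu ^+ i) a *+ 'C(n, i).
transitivity (\sum_(i < K) F i).
  rewrite horner_sum; apply: eq_bigr => i _.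
  rewrite hornerM hornerC -(rmorph_nat (in_alg A)) horner_map bP.
  by rewrite rmorph_nat mulr_natl.
transitivity (\sum_(i < n.+1) F i).
  have [nK|Kn] := leqP n.+1 K.
    by apply: sum_tail0 nK => i ni; rewrite /F bin_small.
  by apply/esym/sum_tail0 => [i Ki|]; [rewrite /F nu0 ?mul0rn | exact: ltnW].
rewrite -[u](subrK 1) -/nu exprD1n conv_sum; apply: eq_bigr => i _.
by rewrite /F -!scaler_nat convZ.
Qed.

Fact power_polys_key : exists P : A -> {poly A},
  forall a n, (P a).[n%:R] = (u ^+ n) a.
Proof. by have /choice[P PE] := power_poly; exists P. Qed.

(** The polynomial in T that stands for u^T at the given element; its coefficient of T is the
    logarithm of u. *)
Definition ppoly : A -> {poly A} := sval (cid power_polys_key).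

Lemma ppolyE a n : (ppoly a).[n%:R] = (u ^+ n) a.
Proof. exact: (svalP (cid power_polys_key)). Qed.

Lemma ppoly_unique a p : (forall n, p.[n%:R] = (u ^+ n) a) -> p = ppoly a.
Proof. by move=> e; apply: (poly_alg_nat_eq char0) => n; rewrite e ppolyE. Qed.

Fact ppoly_coef_linear i : linear (fun a => (ppoly a)`_i).
Proof.
move=> c a b; rewrite -(ppoly_unique (p := c%:A *: ppoly a + ppoly b)).
  by rewrite coefD coefZ mulr_algl.
by move=> n; rewrite hornerD hornerZ mulr_algl !ppolyE linearP.
Qed.

Definition ucoef i : H A := mklin (ppoly_coef_linear i).

Lemma ucoefE i a : ucoef i a = (ppoly a)`_i. Proof. exact: mklinE. Qed.

Local Notation e := (ucoef 1).

Lemma ucoef0 : ucoef 0 = 1.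
Proof.
apply: conv_eq => a; rewrite ucoefE -horner_coef0.
by have := ppolyE a 0; rewrite mulr0n expr0.
Qed.

Lemma ppolyM a b : ppoly (a * b) = ppoly a * ppoly b.
Proof.
apply/esym/ppoly_unique => n; rewrite hornerM !ppolyE.
by have [v vE] := point_conv_power (unipart cG) n; rewrite -!vE rmorphM.
Qed.

Lemma ulog_derivation a b :
  e (a * b) = (1 : H A) a * e b + e a * (1 : H A) b.
Proof.
by rewrite -ucoef0 !ucoefE ppolyM coefM !big_ord_recl big_ord0 addr0.
Qed.

Lemma unipart_push R (g h : Spec A R) :
  push (gmul G g h) u = push g u * push h u.
Proof.
apply: conv_eq => a; rewrite pushE.
have -> : gmul G g h (u a) =
    gmul G (g \o unipart cG : Spec A R) (h \o unipart cG) a.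
  by rewrite unipart_gmul.
rewrite gmulE convM; congr (mul2 _ _ _); apply: linear_eq => b;
  by rewrite pushE.
Qed.

(** Since g |-> g o u is a homomorphism, (gh)(u^n) is the convolution of g(u^n) and h(u^n). Both
    sides are polynomial in n with constant terms the counit, and the coefficients of n give the
    claim. *)
Lemma ulog_primitive a : primitive G (e a).
Proof.
move=> R g h; have [s sE] := comul_sum a.
have : map_poly (gmul G g h) (ppoly a) =
    \sum_(z <- s) map_poly g (ppoly z.1) * map_poly h (ppoly z.2).
  apply: (poly_alg_nat_eq char0) => n; rewrite horner_sum.
  have mapE (g' : Spec A R) b :
      (map_poly g' (ppoly b)).[n%:R] = push g' (u ^+ n) b.
    by rewrite -(rmorph_nat g') horner_map ppolyE pushE.
  rewrite mapE pushX unipart_push exprMn -!pushX (convE_sum _ _ sE).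
  by apply: eq_bigr => z _; rewrite hornerM !mapE.
move=> /(congr1 (fun p : {poly R} => p`_1)); rewrite coef_map /= -ucoefE => ->.
rewrite coef_sum.
have -> : g (e a) + h (e a) = (1 * push h e + push g e * 1 : H R) a.
  by rewrite mul1r mulr1 convD !pushE addrC.
rewrite convD !(convE_sum _ _ sE) -big_split; apply: eq_bigr => z _ /=.
rewrite coefM !big_ord_recl big_ord0 addr0 !coef_map /=.
have e1 (g' : Spec A R) b : (1 : H R) b = g' (ppoly b)`_0.
  by rewrite -ucoefE ucoef0 -pushE push1.
by rewrite (e1 g z.1) (e1 h z.2) !pushE !ucoefE.
Qed.

(** The rule u^(n+m) = u^n u^m, differentiated in n at 0: the differential equation of the
    exponential, checked at every natural m. *)
Lemma ppoly_deriv a s : Delta a = \sum_(z <- s) tpure z.1 z.2 ->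
  (ppoly a)^`() = \sum_(z <- s) (e z.1)%:P * ppoly z.2.
Proof.
move=> sE; apply: (poly_alg_nat_eq char0) => m.
have : ppoly a \Po ('X + (m%:R)%:P) =
    \sum_(z <- s) ppoly z.1 * ((u ^+ m) z.2)%:P.
  apply: (poly_alg_nat_eq char0) => n; rewrite horner_comp horner_sum.
  rewrite hornerD hornerX hornerC -natrD ppolyE exprD (convE_sum _ _ sE).
  by apply: eq_bigr => z _; rewrite hornerM hornerC ppolyE.
move=> /(congr1 (fun p : {poly A} => p^`().[0])).
rewrite deriv_comp hornerM horner_comp !derivE addr0 hornerD hornerX.
rewrite !hornerC add0r mulr1 => ->; rewrite linear_sum !horner_sum.
apply: eq_bigr => z _ /=; rewrite derivM derivC mulr0 addr0 !hornerM !hornerC.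
by rewrite horner_coef0 coef_deriv mulr1n ucoefE ppolyE.
Qed.

Lemma ucoef_recurrence n : ucoef n.+1 *+ n.+1 = e * ucoef n.
Proof.
apply: conv_eq => a; have [s sE] := comul_sum a.
rewrite (convE_sum _ _ sE) -scaler_nat convZ scaler_nat ucoefE -coef_deriv.
rewrite (ppoly_deriv sE) coef_sum; apply: eq_bigr => z _.
by rewrite coefCM !ucoefE.
Qed.

Lemma ucoef_exp n : ucoef n *+ n`! = e ^+ n.
Proof.
elim: n => [|n IH]; first by rewrite ucoef0.
by rewrite factS mulrnA ucoef_recurrence -mulrnAr IH exprS.
Qed.

(** Setting T = 1 gives u = exp(e), so a point restricted to the image of u is determined by its
    values on the image of e; this yields injectivity of the coordinates. *)
Lemma unipart_exp R (g h : Spec A R) : (forall a, g (e a) = h (e a)) ->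
  forall a, g (unipart cG a) = h (unipart cG a).
Proof.
move=> gh a; have -> : unipart cG a = \sum_(i < size (ppoly a)) ucoef i a.
  have := ppolyE a 1; rewrite mulr1n expr1 => <-.
  by rewrite horner_coef; apply: eq_bigr => i _; rewrite expr1n mulr1 ucoefE.
rewrite !linear_sum; apply: eq_bigr => i _ /=.
have /(congr1 (fun f : H R => f a)) : push g (ucoef i) = push h (ucoef i).
  apply: (mulrn_inj char0 (n := i`!.-1)); rewrite prednK ?fact_gt0 //.
  have pushMn (g' : Spec A R) m f : push g' f *+ m = push g' (f *+ m) :> H R.
    apply: conv_eq => b; rewrite pushE -!scaler_nat !convZ pushE.
    by rewrite linearZ.
  rewrite !pushMn ucoef_exp !pushX; congr (_ ^+ _).
  by apply: conv_eq => b; rewrite !pushE.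
by rewrite !pushE.
Qed.

Lemma ulog_grouplike x : grouplike G x -> e x = 0.
Proof.
move=> gx; rewrite ucoefE -(ppoly_unique (p := 1)) ?coef1 // => n.
by rewrite hornerC (convX_grouplike _ _ gx) [toconv _ _ _]unipart_grouplike // expr1n.
Qed.

(** u fixes p and p turns products of points into sums, so u^n(p) = n p. *)
Lemma ulog_id p : primitive G p -> e p = p.
Proof.
move=> pp; rewrite ucoefE -(ppoly_unique (p := p *: 'X)) => [|n].
  by rewrite coefZ coefX mulr1.
rewrite hornerZ hornerX.
elim: n => [|n IH].
  by rewrite mulr0 expr0 (conv1 cG) primitive_counit // scale0r.
have [v vE] := point_conv_power (unipart cG) n; rewrite -vE in IH.
have [w wE] := point_conv_power (unipart cG) n.+1; rewrite -wE.
have -> : w = gmul G (unipart cG) v.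
  apply: lrmorphism_eq => a; rewrite wE exprS gmulE convM.
  by congr (mul2 _ _ _); apply: linear_eq => b; rewrite -vE.
by rewrite pp -IH unipart_primitive // -[n.+1]add1n natrD mulrDr mulr1.
Qed.
End ExpLog.

(** * Exponential of an eps-derivation *)

Section Exponential.
Variables (k : closedFieldType) (A : comAlgType k) (G : group_law (Spec A)).
Variables (cG : commutative_law G) (char0 : [pchar k] =i pred0).
Variables (R : comAlgType k) (d : conv R cG).
Hypothesis d_grouplike : forall x, grouplike G x -> d x = 0.
Local Notation H := (conv R cG).
Hypothesis dM : forall a b, d (a * b) = (1 : H) a * d b + d a * (1 : H) b.

Definition exp_coef n : H := (n`!%:R : k)^-1 *: d ^+ n.

Fact exp_poly_key : exists Q : A -> {poly R}, forall a n, (Q a)`_n = exp_coef n a.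
Proof.
suff /choice[Q QP] : forall a, exists q : {poly R}, forall n, q`_n = exp_coef n a.
  by exists Q.
move=> a; have [K KP] := nilpotency_bound cG a.
exists (\poly_(n < K) exp_coef n a) => n; rewrite coef_poly.
by case: ltnP => // Kn; rewrite convZ KP ?scaler0.
Qed.

(** exp(T d), a polynomial on each element by local nilpotency. The parameter T makes the formal
    derivative available for the product formula. *)
Definition exp_poly : A -> {poly R} := sval (cid exp_poly_key).

Lemma coef_exp_poly a n : (exp_poly a)`_n = exp_coef n a.
Proof. exact: (svalP (cid exp_poly_key)). Qed.

Lemma exp_coefS n : exp_coef n.+1 *+ n.+1 = d * exp_coef n.
Proof.
rewrite -scaler_nat scalerA -scalerAr -exprS factS natrM invfM mulrA mulfV.
  by rewrite mul1r.
by rewrite (natk_eq0 char0).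
Qed.

Lemma exp_coef0 : exp_coef 0 = 1.
Proof. by rewrite /exp_coef fact0 invr1 scale1r. Qed.

(** Convolution by [d] obeys the Leibniz rule on the product formula of index n, which enters as a
    premise; this is the inductive step of [exp_coefM]. *)
Lemma conv_derivation n a b (f : nat -> H) :
  (forall a b, exp_coef n (a * b) =
     \sum_(i < n.+1) exp_coef i a * exp_coef (n - i) b) ->
  (d * exp_coef n) (a * b) = \sum_(i < n.+1)
    ((d * exp_coef i) a * exp_coef (n - i) b +
     exp_coef i a * (d * exp_coef (n - i)) b).
Proof.
move=> IH; have [s sE] := comul_sum cG a; have [t tE] := comul_sum cG b.
have -> : (d * exp_coef n) (a * b) = \sum_(z <- s) \sum_(w <- t)
    d (z.1 * w.1) * exp_coef n (z.2 * w.2).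
  rewrite convM rmorphM /= sE tE mulr_suml linear_sum; apply: eq_bigr => z _.
  rewrite mulr_sumr linear_sum; apply: eq_bigr => w _.
  by rewrite tpureM mul2_pure.
transitivity (\sum_(i < n.+1) \sum_(z <- s) \sum_(w <- t)
    (d z.1 * exp_coef i z.2 * ((1 : H) w.1 * exp_coef (n - i) w.2) +
     (1 : H) z.1 * exp_coef i z.2 * (d w.1 * exp_coef (n - i) w.2))).
  rewrite [RHS]exchange_big; apply: eq_bigr => z _.
  rewrite [RHS]exchange_big; apply: eq_bigr => w _.
  rewrite dM IH mulr_sumr; apply: eq_bigr => i _; ring.
apply: eq_bigr => i _.
rewrite -[exp_coef (n - i) in X in X + _]mul1r -[exp_coef i in X in _ + X]mul1r.
rewrite !(convE_sum _ _ sE) !(convE_sum _ _ tE) !mulr_suml -big_split.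
apply: eq_bigr => z _; rewrite !mulr_sumr -big_split; exact: eq_bigr.
Qed.

Lemma exp_coefM n a b :
  exp_coef n (a * b) = \sum_(i < n.+1) exp_coef i a * exp_coef (n - i) b.
Proof.
elim: n a b => [a b|n IH a b].
  by rewrite big_ord1 exp_coef0 !conv1 rmorphM -scalerAl mul1r scalerA.
apply: (mulrn_inj char0 (n := n)).
have := @conv_derivation n a b; rewrite -exp_coefS -scaler_nat convZ scaler_nat.
move=> -> //.
(* Read as a coefficient of a product, the right side times n + 1 is a coefficient of its
   derivative, and the Leibniz rule for polynomials does the reindexing. *)
rewrite [X in _ = X *+ _](_ : _ = (exp_poly a * exp_poly b)`_n.+1); last first.
  by rewrite coefM; apply: eq_bigr => i _; rewrite !coef_exp_poly.
rewrite -coef_deriv derivM coefD !coefM -big_split; apply: eq_bigr => i _.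
have dE j c : (d * exp_coef j) c = (exp_poly c)`_j.+1 *+ j.+1.
  by rewrite -exp_coefS -scaler_nat convZ scaler_nat coef_exp_poly.
by rewrite [RHS]/= !coef_deriv !dE !coef_exp_poly.
Qed.

Lemma exp_polyM a b : exp_poly (a * b) = exp_poly a * exp_poly b.
Proof.
apply/polyP=> n; rewrite coefM coef_exp_poly exp_coefM.
by apply: eq_bigr => i _; rewrite !coef_exp_poly.
Qed.

Lemma exp_poly_grouplike x : grouplike G x -> exp_poly x = 1.
Proof.
move=> gx; apply/polyP=> n; rewrite coef_exp_poly coef1 convZ.
rewrite (convX_grouplike _ _ gx) d_grouplike //.
case: n => [|n]; last by rewrite expr0n scaler0.
by rewrite fact0 invr1 scale1r.
Qed.

Lemma exp_poly_primitive p : primitive G p -> exp_poly p = d p *: 'X.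
Proof.
move=> pp; apply/polyP=> n; rewrite coef_exp_poly coefZ coefX convZ.
case: n => [|n].
  by rewrite fact0 invr1 scale1r (conv1 cG) primitive_counit // scale0r mulr0.
have -> : (d ^+ n.+1) p = d p * (n == 0%N)%:R; last first.
  case: n => [|n]; first by rewrite invr1 scale1r.
  by rewrite mulr0 scaler0.
rewrite exprS convM (primitive_comul cG pp) linearD /= !mul2_pure.
rewrite (d_grouplike (grouplike1 G)) mul0r addr0.
rewrite (convX_grouplike _ _ (grouplike1 G)) (d_grouplike (grouplike1 G)).
by rewrite expr0n.
Qed.

Fact exp_linear : linear (fun a => (exp_poly a).[1]).
Proof.
move=> c a b; have -> : exp_poly (c *: a + b) = c%:A *: exp_poly a + exp_poly b.
  apply/polyP=> n; rewrite coefD coefZ !coef_exp_poly linearP.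
  by rewrite mulr_algl.
by rewrite hornerD hornerZ mulr_algl.
Qed.

Fact exp_monoid : monoid_morphism (fun a => (exp_poly a).[1]).
Proof.
split=> [|a b]; last by rewrite exp_polyM hornerM.
by rewrite exp_poly_grouplike ?hornerC //; exact: grouplike1.
Qed.

Definition exp_point : Spec A R := mkalg exp_linear exp_monoid.

Lemma exp_point_grouplike x : grouplike G x -> exp_point x = 1.
Proof. by move=> gx; rewrite mkalgE exp_poly_grouplike // hornerC. Qed.

Lemma exp_point_primitive p : primitive G p -> exp_point p = d p.
Proof.
by move=> pp; rewrite mkalgE exp_poly_primitive // hornerZ hornerX mulr1.
Qed.

End Exponential.

(** * The splitting *)

Section FixedSubalgebra.
Variables (k : fieldType) (A : comAlgType k) (s : {lrmorphism A -> A}).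

(** For an idempotent [s] this is its image; the equation makes it a boolean predicate from which a
    subtype algebra is obtained. *)
Definition fixed : {pred A} := fun a => s a == a.

Fact fixed_subalg : subalg_closed fixed.
Proof.
split=> [|c a b|a b]; rewrite !unfold_in ?rmorph1 //.
  by move=> /eqP ea /eqP eb; rewrite linearP /= ea eb.
by move=> /eqP ea /eqP eb; rewrite rmorphM /= ea eb.
Qed.

HB.instance Definition _ :=
  GRing.isSubalgClosed.Build k A fixed (GRing.subalg_closed_semi fixed_subalg).

Record fixalg := FixAlg {fixval :> A; _ : fixval \in fixed}.
HB.instance Definition _ := [isSub for fixval].
HB.instance Definition _ := [Choice of fixalg by <:].
HB.instance Definition _ := [SubChoice_isSubComNzRing of fixalg by <:].
HB.instance Definition _ := [SubZmodule_isSubLmodule of fixalg by <:].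
HB.instance Definition _ := [SubNzRing_SubLmodule_isSubLalgebra of fixalg by <:].
HB.instance Definition _ := [SubLalgebra_isSubAlgebra of fixalg by <:].

Definition fixalgebra : comAlgType k := fixalg.

Fact fix_incl_linear : linear (fixval : fixalgebra -> A).
Proof. by []. Qed.
Fact fix_incl_monoid : monoid_morphism (fixval : fixalgebra -> A).
Proof. by []. Qed.
Definition fix_incl : {lrmorphism fixalgebra -> A} :=
  mkalg fix_incl_linear fix_incl_monoid.

Lemma fix_incl_inj : injective fix_incl.
Proof. by move=> a b; rewrite !mkalgE; exact: val_inj. Qed.

Lemma fix_inclE b : s (fix_incl b) = fix_incl b.
Proof. by rewrite mkalgE; apply/eqP; case: b. Qed.

Hypothesis s_idem : forall a, s (s a) = s a.

Fact fix_proj_proof a : s a \in fixed.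
Proof. by rewrite unfold_in s_idem. Qed.

Definition fix_proj_fun a : fixalgebra := FixAlg (fix_proj_proof a).

Fact fix_proj_linear : linear fix_proj_fun.
Proof. by move=> c a b; apply: val_inj; rewrite /= linearP. Qed.
Fact fix_proj_monoid : monoid_morphism fix_proj_fun.
Proof.
by split=> [|a b]; apply: val_inj; rewrite /= ?rmorph1 ?rmorphM.
Qed.
Definition fix_proj : {lrmorphism A -> fixalgebra} :=
  mkalg fix_proj_linear fix_proj_monoid.

Lemma fix_projK a : fix_incl (fix_proj a) = s a.
Proof. by rewrite !mkalgE. Qed.

Lemma fix_inclK b : fix_proj (fix_incl b) = b.
Proof. by apply: fix_incl_inj; rewrite fix_projK fix_inclE. Qed.

End FixedSubalgebra.

Section Splitting.
Variables (k : closedFieldType) (A : comAlgType k) (G : group_law (Spec A)).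
Variables (cG : commutative_law G) (char0 : [pchar k] =i pred0).
Implicit Types R S : comAlgType k.

Definition ssalg : comAlgType k := fixalgebra (sspart cG).
Local Notation B := ssalg.
Definition ss_incl : {lrmorphism B -> A} := fix_incl (sspart cG).
Definition ss_proj : {lrmorphism A -> B} := fix_proj (sspart_idem cG).

Lemma ss_projK a : ss_incl (ss_proj a) = sspart cG a.
Proof. exact: fix_projK. Qed.
Lemma ss_inclK b : ss_proj (ss_incl b) = b.
Proof. exact: fix_inclK. Qed.

Lemma ss_proj_grouplike x a : grouplike G x -> component G x a ->
  ss_proj a = (counit G a : k) *: ss_proj x.
Proof.
move=> gx ca; apply: (@fix_incl_inj _ _ (sspart cG)).
rewrite linearZ /= !ss_projK (sspart_component cG gx ca).
by rewrite (sspart_grouplike cG gx).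
Qed.

Lemma ss_spanned b : spanned (fun b => grouplike G (ss_incl b)) b.
Proof.
rewrite -(ss_inclK b); elim/(component_ind cG): (ss_incl b) => [|a a' sa sa'|x a gx ca].
- by rewrite linear0; exists [::] => //; rewrite /comb big_nil.
- rewrite linearD /=; have [l il ->] := sa; have [l' il' ->] := sa'.
  by exists (l ++ l'); [exact: inside_cat | rewrite comb_cat].
- rewrite (ss_proj_grouplike gx ca); apply/spanned_scale/spanned_in.
  by rewrite ss_projK sspart_grouplike.
Qed.

Lemma ss_point_eq R (f g : Spec B R) :
  (forall b, grouplike G (ss_incl b) -> f b = g b) -> f = g.
Proof.
move=> e; apply: lrmorphism_eq => b; have [l il ->] := ss_spanned b.
rewrite /comb !linear_sum; apply: eq_big_seq => z /il gz.
by rewrite !linearZ /= e.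
Qed.

(** Points of B become points of G through the retraction and are multiplied there, so B needs no
    comultiplication of its own. *)
Definition ss_mul R (g h : Spec B R) : Spec B R :=
  gmul G (g \o ss_proj : Spec A R) (h \o ss_proj) \o ss_incl.
Definition ss_one R : Spec B R := (gone G R : Spec A R) \o ss_incl.
Definition ss_inv R (g : Spec B R) : Spec B R :=
  ginv G (g \o ss_proj : Spec A R) \o ss_incl.

Lemma ss_mulE R (g h : Spec B R) b : grouplike G (ss_incl b) ->
  ss_mul g h b = g b * h b.
Proof. by move=> gb; rewrite /= gmul_grouplike //= ss_inclK. Qed.

Lemma ss_oneE R b : grouplike G (ss_incl b) -> ss_one R b = 1.
Proof. by move=> gb; rewrite /= gone_grouplike. Qed.

(** The axioms are checked on group-like elements, which span B and on which the law multiplies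
    values. *)
Definition ss_law : group_law (Spec B).
Proof.
refine (@GroupLaw k (Spec B) ss_mul ss_one ss_inv _ _ _ _).
- by move=> R f g h; apply: ss_point_eq => b gb; rewrite !ss_mulE // mulrA.
- by move=> R f; apply: ss_point_eq => b gb; rewrite ss_mulE // ss_oneE // mul1r.
- move=> R f; apply: ss_point_eq => b gb; rewrite ss_mulE // ss_oneE //=.
  have := gmul_grouplike (ginv G (f \o ss_proj : Spec A R)) (f \o ss_proj) gb.
  by rewrite gmulVg gone_grouplike //= ss_inclK.
- move=> R S f g h; apply: ss_point_eq => b gb.
  by rewrite [RHS]ss_mulE //= gmul_grouplike //= !ss_inclK rmorphM.
Defined.

Section Coordinates.
Variables (X : A -> Prop) (primX : forall x, X x -> primitive G x).
Variable indX : independent X.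
Hypothesis spanX : forall p, primitive G p -> spanned X p.

Definition coord_map R (g : Spec A R) :
    pairF (prodF (fun _ : {x | X x} => Spec {poly k})) (Spec B) R :=
  (fun x => Ga_point (g (sval x)), (g \o ss_incl : {lrmorphism B -> R})).

(** The unipotent part of a point is determined by its values on primitive elements, since e takes
    values there; the semisimple part is determined by the restriction to B. *)
Lemma coord_map_inj R : injective (@coord_map R).
Proof.
move=> g h [eX eB].
have gX x : X x -> g x = h x.
  move=> Xx; have := congr1 (fun f : {x | X x} -> Spec {poly k} R =>
    (f (exist _ x Xx) : {lrmorphism {poly k} -> R}) 'X) eX.
  by rewrite !Ga_pointX.
have gP p : primitive G p -> g p = h p.
  move=> /spanX[l il ->]; rewrite /comb !linear_sum; apply: eq_big_seq => z /il Xz.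
  by rewrite !linearZ /= gX.
rewrite (point_decomposition cG g) (point_decomposition cG h).
congr (gmul G _ _); apply: lrmorphism_eq => a /=.
  apply: (unipart_exp (char0 := char0)) => b; apply: gP.
  exact: ulog_primitive.
have := congr1 (fun f : B -> R => f (ss_proj a)) eB.
by rewrite /= ss_projK.
Qed.

Lemma coord_map_surj R y : exists g : Spec A R, coord_map g = y.
Proof.
case: y => r f.
have [Y [XY _ iY sY]] := basis_extension (S := fun=> True) indX (fun _ _ => I) (@spannedT k A).
(* The prescribed coordinates, extended by 0 to the rest of a basis of A, define a linear map [L];
   following e by [L] gives an eps-derivation. *)
pose v x := if pselect (X x) is left Xx then (r (exist _ x Xx) : {lrmorphism {poly k} -> R}) 'X else 0.
have [L LE] := linear_extension v iY sY.
pose e := ucoef cG char0 1.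
pose d : conv R cG := toconv cG (mklin (linearP (L \o e : {linear A -> R}))).
have dE a : d a = L (e a) by exact: mklinE.
have d0 x : grouplike G x -> d x = 0.
  by move=> gx; rewrite dE ulog_grouplike // linear0.
have dM a b : d (a * b) = (1 : conv R cG) a * d b + d a * (1 : conv R cG) b.
  rewrite !dE ulog_derivation linearD !conv1 !mulr_algl !mulr_algr !linearZ.
  by [].
(* The first factor is 1 on group-like elements and the second is 0 on primitive ones, so each
   coordinate sees a single factor. *)
exists (gmul G (exp_point char0 d0 dM) (f \o ss_proj)).
rewrite /coord_map; congr (_, _).
  apply: functional_extensionality_dep => -[x Xx]; apply: Ga_point_eq.
  rewrite Ga_pointX /= (primX Xx) exp_point_primitive ?dE; last exact: primX.
  rewrite ulog_id; last exact: primX.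
  rewrite LE; last exact: XY.
  rewrite [X in _ + X]/=; have -> : ss_proj x = 0.
    apply: (@fix_incl_inj _ _ (sspart cG)); rewrite linear0.
    by rewrite [LHS]ss_projK sspart_primitive //; exact: primX.
  rewrite linear0 addr0 /v; case: pselect => // Xx'.
  by rewrite (Prop_irrelevance Xx' Xx).
apply: ss_point_eq => b gb.
by rewrite /= gmul_grouplike // exp_point_grouplike //= mul1r ss_inclK.
Qed.

Lemma splitting :
  kgroup_isomorphic G (pair_law (prod_law (fun _ : {x | X x} => Ga k)) ss_law).
Proof.
exists coord_map; split.
- move=> R; have /choice[g gK] := @coord_map_surj R; exists g => // x.
  by apply: coord_map_inj; rewrite gK.
- move=> R S f g; congr (_, _).
    apply: functional_extensionality_dep => x; apply: Ga_point_eq.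
    by rewrite /= !Ga_pointX.
  exact: lrmorphism_eq.
- move=> R g h; congr (_, _).
    apply: functional_extensionality_dep => -[x Xx]; apply: Ga_point_eq.
    by rewrite /= !Ga_pointX; apply: primX.
  apply: ss_point_eq => b gb.
  by rewrite [RHS]ss_mulE //= gmul_grouplike.
Qed.

End Coordinates.
End Splitting.

(** * Representations of a group generated by characters *)

Section RightContraction.
Variables (k : fieldType) (V W U : lmodType k).

Section Functional.
Variable f : {linear W -> k^o}.

Fact rcontract_bilinear :
  bilinear_for *:%R *:%R (fun (v : V) (w : W) => (f w : k) *: v).
Proof.
split=> [w c v v'|v c w w'] /=; first by rewrite scalerDr !scalerA mulrC.
by rewrite linearP scalerDl -scalerA.
Qed.

Definition rcontract : {linear tensor V W -> V} :=
  mklin (tensor_lift_linear (mkbil rcontract_bilinear)).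

Lemma rcontract_pure v w : rcontract (pure v w) = (f w : k) *: v.
Proof. rewrite mklinE; exact: tensor_lift_pure. Qed.
End Functional.

Section Map.
Variable g : {linear W -> U}.

Fact rmap_bilinear : bilinear_for *:%R *:%R (fun (v : V) (w : W) => pure v (g w)).
Proof.
split=> [w c v v'|v c w w'] /=; first by rewrite linearPl.
by rewrite linearP linearPr.
Qed.

Definition rmap : {linear tensor V W -> tensor V U} :=
  mklin (tensor_lift_linear (mkbil rmap_bilinear)).

Lemma rmap_pure v w : rmap (pure v w) = pure v (g w).
Proof. rewrite mklinE; exact: tensor_lift_pure. Qed.
End Map.
End RightContraction.

Section Diagonalizable.
Variables (k : fieldType) (B : comAlgType k) (D : group_law (Spec B)).
Implicit Types R S : comAlgType k.

(** A homomorphism from Spec B to the multiplicative group: g(b) is invertible, with inverse the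
    value at b of the inverse point. *)
Definition character (b : B) :=
  (forall R (g h : Spec B R), gmul D g h b = g b * h b) /\
  forall R, gone D R b = 1.

Hypothesis spanned_character : forall b, spanned character b.

Section Representation.
Variables (V : lmodType k) (rho : representation D V).

(** The action of the universal point, which determines [rep rho g] for every [g] by naturality and
    linearity. *)
Definition coaction (v : V) : tensor V B :=
  rep rho (idfun : Spec B B) (pure v 1).

Lemma ext_map_sum R S (f : {lrmorphism R -> S}) (s : seq (V * R)) :
  ext_map f (\sum_(z <- s) pure z.1 z.2 : tensor V R) =
  \sum_(z <- s) pure z.1 (f z.2) :> tensor V S.
Proof.
rewrite /ext_map [LHS]linear_sum; apply: eq_bigr => z _.
exact: tensor_lift_pure.
Qed.

Lemma repE R (g : Spec B R) v (r : R) :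
  rep rho g (pure v r) = ext_scale r (ext_map g (coaction v)).
Proof.
rewrite -(rep_nat rho g (idfun : Spec B B)).
rewrite (_ : fmap g _ = g); last exact: lrmorphism_eq.
rewrite ext_map_pure rmorph1.
rewrite -[RHS](GRing.scalable_linear (rep_linear rho g)); congr rep.
by rewrite [RHS]ext_scale_pure mulr1.
Qed.

Lemma rep_pure R (g : Spec B R) v (r : R) (s : seq (V * B)) :
  coaction v = \sum_(z <- s) pure z.1 z.2 ->
  rep rho g (pure v r) = \sum_(z <- s) pure z.1 (r * g z.2) :> tensor V R.
Proof.
move=> e; rewrite repE e ext_map_sum.
have -> : \sum_(z <- s) pure z.1 (g z.2) =
    \sum_(w <- [seq (z.1, g z.2) | z <- s]) pure w.1 w.2 :> tensor V R.
  by rewrite big_map.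
by rewrite ext_scale_sum big_map.
Qed.

Lemma rep_sum R (g : Spec B R) (I : Type) (r : seq I) (F : I -> tensor V R) :
  rep rho g (\sum_(i <- r) F i) = \sum_(i <- r) rep rho g (F i) :> tensor V R.
Proof.
have repB := GRing.zmod_morphism_linear (rep_linear rho g).
have rep0 : rep rho g 0 = 0 by have := repB 0 0; rewrite !subrr.
have repD t u : rep rho g (t + u) = rep rho g t + rep rho g u.
  rewrite -[u in LHS]opprK repB; congr (_ + _).
  by have := repB 0 u; rewrite rep0 !sub0r => ->; rewrite opprK.
elim: r => [|i r IH]; first by rewrite !big_nil; exact: rep0.
by rewrite !big_cons -IH; exact: repD.
Qed.

Definition weight_vector v := exists2 x, character x & coaction v = pure v x.

(** The coefficients of the coaction of [v] along a basis of B made of characters are the weight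
    components of [v]. *)
Lemma weight_vectors_span v : spanned weight_vector v.
Proof.
have [//|Y [_ charY iY sY]] :=
  basis_extension (@independent0 k B) (S := character) _ spanned_character.
have [p [pY pP]] := coordinates iY sY.
pose t := coaction v; have [s [us sY' sE]] := pP [seq z.2 | z <- repr t].
pose w x := rcontract V (p x) t.
have tE : t = \sum_(z <- [seq (w x, x) | x <- s]) pure z.1 z.2.
  rewrite big_map /= {1}(tensor_sum t) /w.
  under [RHS]eq_bigr do rewrite {1}(tensor_sum t) linear_sum linear_sumlz.
  rewrite exchange_big /=; apply: eq_big_seq => z zt.
  rewrite {1}(sE z.2 (map_f _ zt)) linear_sumr; apply: eq_bigr => x _.
  by rewrite rcontract_pure linearZl_LR linearZr_LR.
have wP y : y \in s -> coaction (w y) = pure (w y) y.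
  move=> ys; pose i1 : Spec B (talg B B) := @inj1 k B B.
  pose i2 : Spec B (talg B B) := @inj2 k B B.
  (* [Phi] extracts the coefficient of [y] in the second tensor factor; applied to multiplicativity
     at the universal pair of points, it isolates the coaction of [w y]. *)
  pose Phi : {linear talg B B -> B} :=
    mul2 (idfun : {linear B -> B}) (mklin (comp_linear (scal B) (p y))).
  have PhiE b b' : Phi (tpure b b') = (p y b' : k) *: b.
    by rewrite mul2_pure mklinE /= mkalgE mulr_algr.
  have pick (F : B -> tensor V B) : \sum_(x <- s) (p y x : k) *: F x = F y.
    rewrite (bigD1_seq y) //= pY ?eqxx ?scale1r; last exact: sY'.
    rewrite big_seq_cond big1 ?addr0 // => x /andP[xs xy].
    by rewrite pY ?(negPf xy) ?scale0r //; exact: sY'.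
  have := congr1 (rmap V Phi : tensor V _ -> _) (repM rho i1 i2 (pure v 1)).
  rewrite (rep_pure _ _ tE) big_map linear_sum /=.
  rewrite (eq_big_seq (fun x => (p y x : k) *: pure (w x) x)) => [|x xs].
    rewrite (pick (fun x => pure (w x) x)) => ->.
    rewrite (rep_pure _ _ tE) big_map rep_sum linear_sum /=.
    rewrite (eq_bigr (fun x => (p y x : k) *: coaction (w x))) => [|x _].
      by rewrite (pick (fun x => coaction (w x))).
    rewrite mul1r (rep_pure _ _ (tensor_sum (coaction (w x)))) linear_sum.
    rewrite [in RHS](tensor_sum (coaction (w x))) scaler_sumr.
    apply: eq_bigr => z _; rewrite rmap_pure inj1E inj2E tpureM mul1r mulr1 PhiE.
    by rewrite linearZr_LR.
  rewrite mul1r rmap_pure (charY _ (sY' x xs)).1 inj1E inj2E tpureM mul1r mulr1.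
  by rewrite PhiE linearZr_LR.
(* The unit acts trivially and sends every character to 1. *)
have -> : v = \sum_(x <- s) w x.
  have := rep1 rho (pure v 1 : tensor V k^o).
  rewrite (rep_pure _ _ tE) big_map => /(congr1 (rcontract V idfun)).
  rewrite rcontract_pure scale1r linear_sum => <-.
  apply: eq_big_seq => x xs; rewrite rcontract_pure /= mul1r.
  by rewrite (charY _ (sY' x xs)).2 scale1r.
apply: spanned_sum => x xs; apply: spanned_in.
by exists x; [exact/charY/sY' | exact: wP].
Qed.

Definition line (v : V) : {pred V} := fun w => `[< exists c : k, w = c *: v >].

Lemma lineP v w : reflect (exists c : k, w = c *: v) (w \in line v).
Proof. exact: asboolP. Qed.

Lemma line_simple v : v != 0 -> weight_vector v ->
  simple_subrepresentation rho (line v).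
Proof.
move=> v0 [x _ vx]; split.
- split=> [|R g t [s sv ->]].
    split=> [|c u w /lineP[a ->] /lineP[b ->]].
      by apply/lineP; exists 0; rewrite scale0r.
    by apply/lineP; exists (c * a + b); rewrite scalerDl scalerA.
  have /choice[c cP] (z : V * R) : exists c : k, z \in s -> z.1 = c *: v.
    by case: (boolP (z \in s)) => [/sv/lineP[c e]|_]; [exists c | exists 0].
  exists [seq (v, c z *: z.2 * g x) | z <- s].
    by move=> _ /mapP[z _ ->]; apply/lineP; exists 1; rewrite scale1r.
  rewrite big_map [LHS]rep_sum; apply: eq_big_seq => z zs.
  rewrite (cP z zs) linearZl_LR -linearZr_LR /=.
  rewrite (rep_pure (s := [:: (v, x)]) g (c z *: z.2)) ?big_seq1 //.
- by exists v => //; apply/lineP; exists 1; rewrite scale1r.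
- move=> W [[W0 WL] _] WV.
  have [[w Ww w0]|W00] := pselect (exists2 w, w \in W & w != 0).
    right=> u; apply/idP/lineP => [/WV/lineP //|[c ->]].
    have /lineP[a wa] := WV w Ww; have a0 : a != 0.
      by apply: contraNneq w0 => a0; rewrite wa a0 scale0r.
    have := WL (c * a^-1) w 0 Ww W0.
    by rewrite addr0 wa scalerA -mulrA mulVf ?mulr1.
  left=> u; rewrite !inE; apply/idP/eqP => [Wu|-> //].
  by apply: contrapT => /eqP u0; apply: W00; exists u.
Qed.

Lemma line_rank_one v : v != 0 -> rank_one (line v).
Proof. by move=> v0; exists v => // w; split=> /lineP. Qed.

(** Coordinate functionals give both existence and uniqueness: applied to any decomposition, the
    functional of index i returns the coefficient of its i-th term. *)
Lemma basis_lines_direct (Z : V -> Prop) :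
  independent Z -> (forall v, spanned Z v) ->
  is_direct_sum (fun i : {v : V | `[< Z v >]} => line (val i)).
Proof.
move=> iZ sZ v; have [p [pZ pP]] := coordinates iZ sZ.
have [s [us sZ' sE]] := pP [:: v].
have valZ (i : {v : V | `[< Z v >]}) : Z (val i) by case: i => z /= /asboolP.
pose r : seq {v : V | `[< Z v >]} := pmap insub s.
have rE : map val r = s.
  rewrite /r pmap_filter; last exact: insubK.
  apply/all_filterP/allP=> x xs; rewrite isSome_insub.
  by apply/asboolP; exact: sZ'.
have ur : uniq r by apply: pmap_sub_uniq.
have vE := sE v (mem_head _ _).
pose f (i : {v : V | `[< Z v >]}) : V := (p (val i) v : k) *: val i.
have f0 i : i \notin r -> f i = 0.
  move=> ir; rewrite /f vE linear_sum /= big_seq big1 ?scale0r // => x xs.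
  rewrite linearZ /= (pZ _ _ (sZ' x xs)) /GRing.scale /=.
  case: eqP => [xi|_]; last by rewrite mulr0.
  by move: ir; rewrite -(mem_map val_inj) rE (_ : val i = x) ?xs.
exists f; split.
- split=> [|i|].
  + apply: (sub_finite_set (B := [set` r]%classic)); last exact: finite_seq.
    by move=> i /=; apply: contraNT => /f0->.
  + by apply/lineP; exists (p (val i) v).
  + rewrite (fsbigE r) // => [|i _]; last exact: f0.
    under eq_bigl do rewrite in_setT.
    by rewrite {1}vE -rE big_map.
move=> f' [finf' lf' vf']; apply: funext => i.
have /finite_seqP[r' r'E] := finf'.
have f'0 j : j \notin undup r' -> f' j = 0.
  rewrite mem_undup; apply: contraNeq => f'j.
  by have : [set` r']%classic j by rewrite -r'E.
have /choice[c cE] j : exists c : k, f' j = c *: val j by apply/lineP.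
rewrite (fsbigE (undup r')) ?undup_uniq // in vf'; last first.
  by move=> j _; exact: f'0.
rewrite /f vf' linear_sum /=.
under eq_bigl do rewrite in_setT.
rewrite (eq_bigr (fun j => if j == i then c i else 0)); last first.
  move=> j _; rewrite cE linearZ /= (pZ _ _ (valZ j)) /GRing.scale /=.
  by rewrite (inj_eq val_inj); case: eqP => [->|]; rewrite ?mulr1 ?mulr0.
rewrite -big_mkcond -big_filter.
have [ir|/[dup] ir /f'0 fi] := boolP (i \in undup r').
  by rewrite filter_pred1_uniq ?undup_uniq // big_seq1 -cE.
rewrite fi big1_seq ?scale0r // => j.
by rewrite mem_filter => /andP[_ /andP[/eqP->]]; rewrite (negPf ir).
Qed.

End Representation.

Theorem diagonalizable_of_characters : diagonalizable_group D.
Proof.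
move=> V rho.
have [//|Z [_ wZ iZ sZ]] := basis_extension (@independent0 k V)
  (S := weight_vector rho) _ (weight_vectors_span rho).
exists {v : V | `[< Z v >]}, (fun i => line (val i)); split.
  move=> i; have Zi : Z (val i) by case: i => z /= /asboolP.
  have i0 := independent_neq0 iZ Zi.
  by split; [apply: line_simple => //; exact: wZ | exact: line_rank_one].
exact: basis_lines_direct.
Qed.

End Diagonalizable.

Theorem theorem4p3 (k : closedFieldType) (char0 : [pchar k] =i pred0)
    (A : comAlgType k) (G : group_law (Spec A)) (abelianG : commutative_law G) :
  exists (X : Type) (B : comAlgType k) (D : group_law (Spec B)),
    diagonalizable_group D /\
    kgroup_isomorphic G (pair_law (prod_law (fun _ : X => Ga k)) D).
Proof.
have [//|X [_ primX indX spanX]] :=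
  basis_exists (@independent0 k A) (S := primitive G) _.
exists {x : A | X x}, (ssalg abelianG), (ss_law abelianG); split.
  apply: diagonalizable_of_characters => b.
  apply: (spanned_trans _ (ss_spanned b)) => x gx; apply: spanned_in.
  by split=> [R g h|R]; [exact: ss_mulE | exact: ss_oneE].
exact: splitting.
Qed.
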